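(* Let $(F,E,L)$ be a $\sigma$-admissible triple with $(F^\times)_{\mathrm{tor}}\neq F^\times$, let $t,\theta\in E$ be distinct, $n,r$ positive integers, $\alpha_1,\dots,\alpha_r\in E$, and let $\Omega=(\Omega_l)_l\in L^\times$ and $L_{\alpha_j,n}=(L_{\alpha_j,n,l})_l\in L$ ($1\le j\le r$) satisfy $\sigma(\Omega)=(t-\theta)\Omega$, each $\Omega_l$ transcendental over $E$, and $\sigma(L_{\alpha_j,n})=\sigma(\alpha_j)+L_{\alpha_j,n}/(t-\theta)^n$. Let $\Gamma$ and $\Lambda_l$ be as in the context, and assume that $\Gamma(F)$ is Zariski dense in $\Gamma$ or that $\Lambda_l/F$ is a regular extension for each $l$. For each $l$ put $N_l:=\langle L_{\alpha_1,n,l},\dots,L_{\alpha_r,n,l},\Omega_l^{-n},1\rangle_E\subset L_l$. Then for all $l,l'\in\mathbb{Z}/d$, $$\mathrm{tdeg}_E\Lambda_{l'}\le\dim_EN_l\le\mathrm{tdeg}_E\Lambda_{l'}+1.$$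
   Context: A $\sigma$-admissible triple $(F,E,L)$ consists of a positive integer $d$, rings $F\subset E\subset L$ with $F,E$ fields and $L=\prod_{l\in\mathbb{Z}/d}L_l$ a finite product of fields, and a ring endomorphism $\sigma:L\to L$ with $\sigma(E)\subset E$, $\sigma(L_l)\subset L_{l+1}$, $F=E^\sigma=L^\sigma$, and $L$ separable over $E$; $\sigma$ acts on matrices entrywise. Let $\Phi\in\mathrm{GL}_{r+1}(E)$ be the matrix with first column $((t-\theta)^n,\sigma(\alpha_1)(t-\theta)^n,\dots,\sigma(\alpha_r)(t-\theta)^n)^{T}$, diagonal entries $1$ in positions $2,\dots,r+1$, and all other entries $0$; let $\Psi\in\mathrm{GL}_{r+1}(L)$ be the matrix with first column $(\Omega^n,\Omega^nL_{\alpha_1,n},\dots,\Omega^nL_{\alpha_r,n})^T$, diagonal entries $1$ in positions $2,\dots,r+1$, all other entries $0$; then $\sigma\Psi=\Phi\Psi$. With $X$ an $(r+1)\times(r+1)$ matrix of indeterminates and $\Delta=\det X$, $\Gamma:=\mathrm{Spec}\,F[X,\Delta^{-1}]/\ker(X\mapsto(\Psi_{ij}\otimes1)^{-1}(1\otimes\Psi_{ij})\in\mathrm{GL}_{r+1}(L\otimes_EL))$. $\Lambda_l$ is the subfield of $L_l$ generated over $E$ by the $L_l$-components of the entries of $\Psi$, i.e. $\Lambda_l=E(\Omega_l^n,L_{\alpha_1,n,l},\dots,L_{\alpha_r,n,l})$. A regular extension is a separable one in which the base field is algebraically closed. *)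

(* Defs.v *)
From HB Require Import structures.
From mathcomp Require Import all_boot all_algebra generic_quotient ring_quotient.
From mathcomp Require Import boolp.
From mathcomp Require Import mpoly.

Set Implicit Arguments.
Unset Strict Implicit.
Unset Printing Implicit Defensive.

Import GRing.Theory.
Local Open Scope ring_scope.
Local Open Scope quotient_scope.

(* A (x)_k B is built as formal sums of pure tensors, a seq of pairs standing *)
(* for the sum of its entries, modulo the congruence generated by             *)
(* k-bilinearity. Signs are absorbed in the entries.                          *)
Section Tensor.
Variables (k A B : comNzRingType).
Variables (i : {rmorphism k -> A}) (j : {rmorphism k -> B}).

Inductive tensor_eq : seq (A * B) -> seq (A * B) -> Prop :=
| TensorRefl s : tensor_eq s s
| TensorSym s t : tensor_eq s t -> tensor_eq t s
| TensorTrans s t u : tensor_eq s t -> tensor_eq t u -> tensor_eq s u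
| TensorCat s s' t t' :
    tensor_eq s s' -> tensor_eq t t' -> tensor_eq (s ++ t) (s' ++ t')
| TensorComm s t : tensor_eq (s ++ t) (t ++ s)
| Tensor0 b : tensor_eq [:: (0, b)] [::]
| TensorDl a a' b : tensor_eq [:: (a + a', b)] [:: (a, b); (a', b)]
| TensorDr a b b' : tensor_eq [:: (a, b + b')] [:: (a, b); (a, b')]
| TensorZ c a b : tensor_eq [:: (i c * a, b)] [:: (a, j c * b)].

Definition tensor_equiv : rel (seq (A * B)) := fun s t => `[< tensor_eq s t >].

Fact tensor_equiv_refl : reflexive tensor_equiv.
Proof. by move=> s; apply/asboolP/TensorRefl. Qed.
Fact tensor_equiv_sym : ssrbool.symmetric tensor_equiv.
Proof. by move=> s t; apply/asboolP/asboolP => /TensorSym. Qed.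
Fact tensor_equiv_trans : transitive tensor_equiv.
Proof.
by move=> t s u /asboolP st /asboolP tu; apply/asboolP/(TensorTrans st tu).
Qed.

Canonical tensor_equiv_rel :=
  EquivRel tensor_equiv tensor_equiv_refl tensor_equiv_sym tensor_equiv_trans.

Definition tensor := {eq_quot tensor_equiv}.
HB.instance Definition _ := Choice.on tensor.
HB.instance Definition _ := EqQuotient.on tensor.

Definition pure (a : A) (b : B) : tensor := \pi_tensor [:: (a, b)].

Definition tmuls (s t : seq (A * B)) : seq (A * B) :=
  [seq (x.1 * y.1, x.2 * y.2) | x <- s, y <- t].
Definition topps (s : seq (A * B)) : seq (A * B) := [seq (- x.1, x.2) | x <- s].

Definition tensor_zero : tensor := \pi_tensor [::].
Definition tensor_one : tensor := \pi_tensor [:: (1, 1)].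
Definition tensor_add (x y : tensor) : tensor :=
  \pi_tensor (repr x ++ repr y).
Definition tensor_opp (x : tensor) : tensor := \pi_tensor (topps (repr x)).
Definition tensor_mul (x y : tensor) : tensor :=
  \pi_tensor (tmuls (repr x) (repr y)).

Lemma tensorP s t : reflect (tensor_eq s t) (\pi_tensor s == \pi_tensor t).
Proof. by rewrite eqmodE; apply: asboolP. Qed.

Lemma tensor_piP s t : \pi_tensor s = \pi_tensor t <-> tensor_eq s t.
Proof. by split=> [/eqP/tensorP|/tensorP/eqP]. Qed.

Lemma tensorW x : exists s, x = \pi_tensor s.
Proof. by exists (repr x); rewrite reprK. Qed.

Lemma tensor_reprP s : tensor_eq (repr (\pi_tensor s)) s.
Proof. by apply/tensor_piP; rewrite reprK. Qed.

Lemma topps_eq s t : tensor_eq s t -> tensor_eq (topps s) (topps t).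
Proof.
elim=> {s t} [s|s t _ IH|s t u _ I1 _ I2|s s' t t' _ I1 _ I2|s t|b|a a' b|a b b'|c a b] /=.
- exact: TensorRefl.
- exact: TensorSym.
- exact: TensorTrans I1 I2.
- by rewrite /topps !map_cat; apply: TensorCat.
- by rewrite /topps !map_cat; apply: TensorComm.
- by rewrite oppr0; apply: Tensor0.
- by rewrite opprD; apply: TensorDl.
- exact: TensorDr.
- by rewrite -mulrN; apply: TensorZ.
Qed.

Lemma tmuls_catl s1 s2 t : tmuls (s1 ++ s2) t = tmuls s1 t ++ tmuls s2 t.
Proof. exact: allpairs_cat. Qed.

Lemma tmuls_eql s s' t : tensor_eq s s' -> tensor_eq (tmuls s t) (tmuls s' t).
Proof.
elim=> {s s'} [s|s u _ IH|s v u _ I1 _ I2|s s' v v' _ I1 _ I2|s v|b|a a' b|a b b'|c a b].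
- exact: TensorRefl.
- exact: TensorSym.
- exact: TensorTrans I1 I2.
- by rewrite !tmuls_catl; apply: TensorCat.
- by rewrite !tmuls_catl; apply: TensorComm.
- rewrite /tmuls /= cats0; elim: t => [|y t IH] /=; first exact: TensorRefl.
  rewrite mul0r; apply: (TensorCat (s := [:: _]) (s' := [::]) _ IH).
  exact: Tensor0.
- rewrite /tmuls /= !cats0; elim: t => [|y t IH] /=; first exact: TensorRefl.
  rewrite mulrDl.
  apply: TensorTrans (TensorCat (TensorDl _ _ _) IH) _ => /=.
  apply: (TensorCat (s := [:: _]) (s' := [:: _])); first exact: TensorRefl.
  set u := [seq _ | y <- t]; set v := [seq _ | y <- t].
  rewrite -cat1s catA -[X in tensor_eq _ (_ ++ X)]cat1s catA.
  by apply: TensorCat; [exact: TensorComm | exact: TensorRefl].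
- rewrite /tmuls /= !cats0; elim: t => [|y t IH] /=; first exact: TensorRefl.
  rewrite mulrDl.
  apply: TensorTrans (TensorCat (TensorDr _ _ _) IH) _ => /=.
  apply: (TensorCat (s := [:: _]) (s' := [:: _])); first exact: TensorRefl.
  set u := [seq _ | y <- t]; set v := [seq _ | y <- t].
  rewrite -cat1s catA -[X in tensor_eq _ (_ ++ X)]cat1s catA.
  by apply: TensorCat; [exact: TensorComm | exact: TensorRefl].
- rewrite /tmuls /= !cats0; elim: t => [|y t IH] /=; first exact: TensorRefl.
  rewrite -!mulrA; apply: (TensorCat (s := [:: _]) (s' := [:: _]) _ IH).
  exact: TensorZ.
Qed.

Lemma perm_tensor_eq s t : perm_eq s t -> tensor_eq s t.
Proof.
elim: s t => [|x s IH] t.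
  by rewrite perm_sym => /perm_nilP ->; apply: TensorRefl.
move=> st; have /rot_to [n t' def_t] : x \in t.
  by rewrite -(perm_mem st) mem_head.
have tt' : tensor_eq t (x :: t').
  by rewrite -def_t -{1}(cat_take_drop n t); apply: TensorComm.
apply: TensorTrans (TensorSym tt').
apply: (TensorCat (s := [:: x]) (s' := [:: x])); first exact: TensorRefl.
by apply: IH; rewrite -(perm_cons x) -def_t (perm_trans st) // perm_sym perm_rot.
Qed.

Lemma tmulsC s t : tensor_eq (tmuls s t) (tmuls t s).
Proof.
apply: perm_tensor_eq; elim: t => [|y t IH].
  by rewrite /tmuls; elim: s.
have -> : tmuls (y :: t) s = tmuls [:: y] s ++ tmuls t s by rewrite -tmuls_catl.
rewrite /tmuls (perm_allpairs_consr _ _ (fun=> y) (fun=> t)).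
apply: perm_cat IH; rewrite allpairs1l.
by under eq_map do rewrite mulrC [X in (_, X)]mulrC.
Qed.

Lemma tmulsA s t u : tmuls s (tmuls t u) = tmuls (tmuls s t) u.
Proof.
elim: s => // x s IH.
rewrite /tmuls !allpairs_cons -!/(tmuls _ _) tmuls_catl IH; congr (_ ++ _).
rewrite /tmuls map_allpairs allpairs_mapl.
by apply: eq_allpairs => y z /=; rewrite !mulrA.
Qed.

Lemma tensor_addE s t :
  tensor_add (\pi_tensor s) (\pi_tensor t) = \pi_tensor (s ++ t).
Proof. by apply/tensor_piP; apply: TensorCat; apply: tensor_reprP. Qed.

Lemma tensor_oppE s : tensor_opp (\pi_tensor s) = \pi_tensor (topps s).
Proof. by apply/tensor_piP/topps_eq/tensor_reprP. Qed.

Lemma tensor_mulE s t :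
  tensor_mul (\pi_tensor s) (\pi_tensor t) = \pi_tensor (tmuls s t).
Proof.
apply/tensor_piP; apply: TensorTrans (tmuls_eql _ (tensor_reprP s)) _.
apply: TensorTrans (tmulsC _ _) _; apply: TensorTrans (tmulsC _ _).
exact/tmuls_eql/tensor_reprP.
Qed.

Fact tensor_addA : associative tensor_add.
Proof.
by move=> x y z; have [s ->] := tensorW x; have [t ->] := tensorW y; have [u ->] := tensorW z; rewrite !tensor_addE catA.
Qed.
Fact tensor_addC : commutative tensor_add.
Proof.
by move=> x y; have [s ->] := tensorW x; have [t ->] := tensorW y; rewrite !tensor_addE; apply/tensor_piP/TensorComm.
Qed.
Fact tensor_add0 : left_id tensor_zero tensor_add.
Proof. by move=> x; have [s ->] := tensorW x; rewrite tensor_addE. Qed.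
Fact tensor_addN : left_inverse tensor_zero tensor_opp tensor_add.
Proof.
move=> x; have [s ->] := tensorW x; rewrite tensor_oppE tensor_addE; apply/tensor_piP.
elim: s => [|[a b] s IH] /=; first exact: TensorRefl.
apply: (TensorTrans (t := [:: (- a, b); (a, b)] ++ (topps s ++ s))).
  by apply: perm_tensor_eq; rewrite /= perm_cons -cat1s perm_catCA.
apply: TensorTrans (TensorCat (Tensor0 b) IH); rewrite -(addNr a).
by apply: TensorCat; [exact/TensorSym/TensorDl | exact: TensorRefl].
Qed.
HB.instance Definition _ := GRing.isZmodule.Build tensor
  tensor_addA tensor_addC tensor_add0 tensor_addN.

Fact tensor_mulA : associative tensor_mul.
Proof.
by move=> x y z; have [s ->] := tensorW x; have [t ->] := tensorW y; have [u ->] := tensorW z; rewrite !tensor_mulE tmulsA.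
Qed.
Fact tensor_mulC : commutative tensor_mul.
Proof.
by move=> x y; have [s ->] := tensorW x; have [t ->] := tensorW y; rewrite !tensor_mulE; apply/tensor_piP/tmulsC.
Qed.
Fact tensor_mul1 : left_id tensor_one tensor_mul.
Proof.
move=> x; have [s ->] := tensorW x; rewrite tensor_mulE /tmuls /= cats0 -[in RHS](map_id s).
by congr \pi_tensor; apply: eq_map => -[a b] /=; rewrite !mul1r.
Qed.
Fact tensor_mulDl : left_distributive tensor_mul +%R.
Proof.
move=> x y z; have [s ->] := tensorW x; have [t ->] := tensorW y; have [u ->] := tensorW z.
by rewrite /GRing.add/= tensor_addE !tensor_mulE tmuls_catl tensor_addE.
Qed.
HB.instance Definition _ := GRing.Zmodule_isComPzRing.Build tensor
  tensor_mulA tensor_mulC tensor_mul1 tensor_mulDl.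

Definition tensorl (a : A) : tensor := pure a 1.
Definition tensorr (b : B) : tensor := pure 1 b.

Lemma pureDl a a' b : pure (a + a') b = pure a b + pure a' b.
Proof. by rewrite [RHS]tensor_addE; apply/tensor_piP/TensorDl. Qed.
Lemma pureDr a b b' : pure a (b + b') = pure a b + pure a b'.
Proof. by rewrite [RHS]tensor_addE; apply/tensor_piP/TensorDr. Qed.
Lemma pureNl a b : pure (- a) b = - pure a b.
Proof. by rewrite [RHS]tensor_oppE. Qed.
Lemma pureZ c a b : pure (i c * a) b = pure a (j c * b).
Proof. exact/tensor_piP/TensorZ. Qed.
Lemma pureNr a b : pure a (- b) = - pure a b.
Proof.
by rewrite -pureNl -[- b]mulN1r -(rmorph1 j) -rmorphN -pureZ rmorphN1 mulN1r.
Qed.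
Lemma pureM a b a' b' : pure a b * pure a' b' = pure (a * a') (b * b').
Proof. exact: tensor_mulE. Qed.

Fact tensorl_zmod : zmod_morphism tensorl.
Proof. by move=> a a'; rewrite /tensorl pureDl pureNl. Qed.
Fact tensorl_monoid : monoid_morphism tensorl.
Proof.
by split=> // a a'; rewrite [RHS]pureM mulr1.
Qed.
HB.instance Definition _ := GRing.isZmodMorphism.Build A tensor tensorl tensorl_zmod.
HB.instance Definition _ := GRing.isMonoidMorphism.Build A tensor tensorl tensorl_monoid.

Fact tensorr_zmod : zmod_morphism tensorr.
Proof. by move=> b b'; rewrite /tensorr pureDr pureNr. Qed.
Fact tensorr_monoid : monoid_morphism tensorr.
Proof.
by split=> // a a'; rewrite [RHS]pureM mulr1.
Qed.
HB.instance Definition _ := GRing.isZmodMorphism.Build B tensor tensorr tensorr_zmod.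
HB.instance Definition _ := GRing.isMonoidMorphism.Build B tensor tensorr tensorr_monoid.

End Tensor.

Section TensorSquare.
Variables (k A : comNzRingType) (i : {rmorphism k -> A}).

Definition tensor_sq := tensor i i.
HB.instance Definition _ := GRing.ComPzRing.on tensor_sq.

(* Evaluating formal sums by a (x) b |-> a * b shows that A (x)_k A <> 0. *)
Fact tensor_sq_oner_neq0 : 1 != 0 :> tensor_sq.
Proof.
suff mul_eq s t : tensor_eq i i s t ->
    \sum_(x <- s) x.1 * x.2 = \sum_(x <- t) x.1 * x.2.
  apply/eqP => one0; have /mul_eq/eqP : tensor_eq i i [:: (1, 1)] [::].
    exact/tensor_piP.
  by rewrite big_seq1 big_nil mulr1 oner_eq0.
elim=> {s t} // [s t u _ -> //|s s' t t' _ E _ E'|s t|b|a a' b|a b b'|c a b].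
- by rewrite !big_cat /= E E'.
- by rewrite !big_cat /= addrC.
- by rewrite big_seq1 big_nil mul0r.
- by rewrite !big_cons !big_nil !addr0 mulrDl.
- by rewrite !big_cons !big_nil !addr0 mulrDr.
- by rewrite !big_seq1 /= mulrCA mulrA.
Qed.
HB.instance Definition _ :=
  GRing.PzSemiRing_isNonZero.Build tensor_sq tensor_sq_oner_neq0.

Definition inl_sq (a : A) : tensor_sq := tensorl i i a.
Definition inr_sq (a : A) : tensor_sq := tensorr i i a.
HB.instance Definition _ := GRing.RMorphism.copy inl_sq (tensorl i i).
HB.instance Definition _ := GRing.RMorphism.copy inr_sq (tensorr i i).
End TensorSquare.

Definition reduced (R : pzRingType) :=
  forall (x : R) (m : nat), x ^+ m = 0 -> x = 0.

(* Separability in the sense of Bourbaki, for k-algebras that need not be     *)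
(* algebraic over k.                                                          *)
Definition separable_algebra (k : fieldType) (A : comNzRingType)
    (i : {rmorphism k -> A}) :=
  forall (k' : fieldType) (j : {rmorphism k -> k'}), reduced (tensor i j).

Section GeneratedSubfield.
Variables (k K : fieldType) (i : {rmorphism k -> K}) (S : K -> Prop).

Definition gen_subfield : {pred K} := fun x =>
  `[< forall M : {pred K}, divring_closed M -> (forall a, i a \in M) ->
        (forall y, S y -> y \in M) -> x \in M >].

Fact gen_subfield_divring_closed : divring_closed gen_subfield.
Proof.
split=> [|x y /asboolP gx /asboolP gy|x y /asboolP gx /asboolP gy];
  apply/asboolP => M M_div kM SM; case: (M_div) => M1 MB Mdiv //.
  by apply: MB; [apply: gx | apply: gy].
by apply: Mdiv; [apply: gx | apply: gy].
Qed.
HB.instance Definition _ :=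
  GRing.isDivringClosed.Build K gen_subfield gen_subfield_divring_closed.

Definition gen_field := {x : K | x \in gen_subfield}.
HB.instance Definition _ := SubChoice.on gen_field.
HB.instance Definition _ := [SubChoice_isSubIntegralDomain of gen_field by <:].
HB.instance Definition _ := [SubIntegralDomain_isSubField of gen_field by <:].

Fact gen_subfield_base a : i a \in gen_subfield.
Proof. by apply/asboolP => M _ kM _; apply: kM. Qed.
Definition gen_base (a : k) : gen_field := Sub (i a) (gen_subfield_base a).
Fact gen_base_zmod : zmod_morphism gen_base.
Proof. by move=> a b; apply: val_inj; rewrite /= !rmorphB. Qed.
Fact gen_base_monoid : monoid_morphism gen_base.
Proof.
by split=> [|a b]; apply: val_inj; rewrite /= ?rmorph1 ?rmorphM.
Qed.
HB.instance Definition _ :=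
  GRing.isZmodMorphism.Build k gen_field gen_base gen_base_zmod.
HB.instance Definition _ :=
  GRing.isMonoidMorphism.Build k gen_field gen_base gen_base_monoid.
End GeneratedSubfield.

Definition regular_extension (k K : fieldType) (i : {rmorphism k -> K}) :=
  separable_algebra i /\
  forall x : K, algebraicOver i x -> exists a : k, i a = x.

(* Some n satisfying P; the value is irrelevant when there is none. *)
Definition nat_such_that (P : nat -> Prop) : nat :=
  if pselect (exists n, P n) is left exP then sval (cid exP) else 0%N.

Section Degrees.
Variables (k K : fieldType) (i : {rmorphism k -> K}).

Definition algebraically_independent (n : nat) (x : 'I_n -> K) :=
  forall p : {mpoly k[n]}, mmap i x p = 0 -> p = 0.

Definition transcendence_basis (n : nat) (x : 'I_n -> K) :=
  algebraically_independent x /\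
  forall y : K,
    algebraicOver (\val : gen_field i (fun z => exists m, z = x m) -> K) y.

Definition trdeg : nat :=
  nat_such_that (fun n => exists x : 'I_n -> K, transcendence_basis x).

Definition lin_span (s : seq K) (y : K) :=
  exists c : 'I_(size s) -> k, y = \sum_(m < size s) i (c m) * s`_m.

Definition linearly_independent (s : seq K) :=
  forall c : 'I_(size s) -> k,
    \sum_(m < size s) i (c m) * s`_m = 0 -> forall m, c m = 0.

Definition basis_for (V : K -> Prop) (s : seq K) :=
  linearly_independent s /\ forall y, V y <-> lin_span s y.

Definition dimension (V : K -> Prop) : nat :=
  nat_such_that (fun n => exists2 s, size s = n & basis_for V s).
End Degrees.

(* L is given as a ring with projections L -> factor l identifying it with    *)
(* the product of the fields factor l. The factor L_l sits in L as the        *)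
(* elements all of whose other projections vanish.                            *)
Record sigma_admissible := SigmaAdmissible {
  period : nat;
  period_gt0 : (0 < period)%N;
  fieldF : fieldType;
  fieldE : fieldType;
  ringL : comUnitRingType;
  factor : 'I_period -> fieldType;
  F_to_E : {rmorphism fieldF -> fieldE};
  E_to_L : {rmorphism fieldE -> ringL};
  proj : forall l, {rmorphism ringL -> factor l};
  sigma : {rmorphism ringL -> ringL};
  proj_bij : forall y : (forall l, factor l), exists! x, forall l, proj l x = y l;
  sigma_E : forall a, exists b, sigma (E_to_L a) = E_to_L b;
  sigma_shift : forall l x, (forall l', l' != l -> proj l' x = 0) ->
    forall l', l' != ordS l -> proj l' (sigma x) = 0;
  sigma_fixed_E :
    forall a, sigma (E_to_L a) = E_to_L a <-> exists b, a = F_to_E b;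
  sigma_fixed_L :
    forall x, sigma x = x <-> exists b, x = E_to_L (F_to_E b);
  L_separable : separable_algebra E_to_L
}.

Section Gamma.
Variables (T : sigma_admissible) (N : nat) (Psi : 'M[ringL T]_N).

Local Notation F := (fieldF T).
Local Notation LL := (tensor_sq (E_to_L T)).

(* F[X, 1/Delta] is F[X][Y] / (Delta Y - 1), so its ideals are handled as     *)
(* ideals of F[X][Y]; the variable of index mxvec_index a b is X_ab.          *)
Definition GL_poly := {poly {mpoly F[N * N]}}.

(* The value at X = g, Y = d. *)
Definition GL_eval (R : comNzRingType) (f : {rmorphism F -> R})
    (g : 'M[R]_N) (d : R) (p : GL_poly) : R :=
  (map_poly (mmap f (fun m => mxvec g 0 m)) p).[d].

Definition F_to_LL : {rmorphism F -> LL} :=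
  inl_sq (E_to_L T) \o (E_to_L T \o F_to_E T).

Definition Psi_l : 'M[LL]_N := map_mx (inl_sq (E_to_L T)) Psi.
Definition Psi_r : 'M[LL]_N := map_mx (inr_sq (E_to_L T)) Psi.
Definition Psi_l_inv : 'M[LL]_N := map_mx (inl_sq (E_to_L T)) (invmx Psi).
Definition Psi_r_inv : 'M[LL]_N := map_mx (inr_sq (E_to_L T)) (invmx Psi).

(* The kernel of X |-> Psi_l^-1 Psi_r, which sends 1 / Delta to the           *)
(* determinant of Psi_r^-1 Psi_l. It contains Delta Y - 1.                    *)
Definition Gamma_ideal (p : GL_poly) :=
  GL_eval F_to_LL (Psi_l_inv *m Psi_r) (\det (Psi_r_inv *m Psi_l)) p = 0.

(* The points of Spec F[X, 1/Delta] / Gamma_ideal, as primes of F[X][Y].      *)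
Definition Gamma (P : {pred GL_poly}) :=
  [/\ idealr_closed P, prime_idealr_closed P &
      forall p, Gamma_ideal p -> p \in P].

Definition Gamma_F (g : 'M[F]_N) :=
  g \in unitmx /\
  forall p, Gamma_ideal p -> GL_eval idfun g (\det g)^-1 p = 0.

Definition point_of (g : 'M[F]_N) : {pred GL_poly} :=
  fun p => GL_eval idfun g (\det g)^-1 p == 0.

Definition closed_locus (S : GL_poly -> Prop) (P : {pred GL_poly}) :=
  forall p, S p -> p \in P.

Definition Gamma_F_dense :=
  forall S : GL_poly -> Prop,
    (forall g, Gamma_F g -> closed_locus S (point_of g)) ->
    forall P, Gamma P -> closed_locus S P.
End Gamma.

Section Psi.
Variables (T : sigma_admissible) (n r : nat).
Variables (Omega : ringL T) (Lpol : 'I_r -> ringL T).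

Definition Psi : 'M[ringL T]_(1 + r) :=
  block_mx (Omega ^+ n)%:M 0 (\col_j (Omega ^+ n * Lpol j)) 1%:M.

Definition E_to_factor l : {rmorphism fieldE T -> factor l} :=
  proj l \o E_to_L T.

Definition Lambda l : fieldType :=
  gen_field (E_to_factor l) (fun x => exists a b, x = proj l (Psi a b)).
Definition E_to_Lambda l : {rmorphism fieldE T -> Lambda l} :=
  gen_base (E_to_factor l) (fun x => exists a b, x = proj l (Psi a b)).
Definition F_to_Lambda l : {rmorphism fieldF T -> Lambda l} :=
  E_to_Lambda l \o F_to_E T.

Definition Nspace_gens l : seq (factor l) :=
  rcons (rcons [seq proj l (Lpol j) | j <- enum 'I_r] (proj l Omega ^- n)) 1.
Definition Nspace l : factor l -> Prop := 
  lin_span (E_to_factor l) (Nspace_gens l).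
End Psi.

Arguments E_to_factor {T} l.
Arguments Psi {T} n {r} Omega Lpol.
Arguments Lambda {T} n {r} Omega Lpol l.
Arguments E_to_Lambda {T} n {r} Omega Lpol l.
Arguments F_to_Lambda {T} n {r} Omega Lpol l.
Arguments Nspace {T} n {r} Omega Lpol l _.

(* Main.v *)
Require Import Defs.
From HB Require Import structures.
From mathcomp Require Import all_boot all_order all_algebra polyXY generic_quotient.
From mathcomp Require Import boolp classical_sets mpoly zify ring.
Set Implicit Arguments.
Unset Strict Implicit.
Unset Printing Implicit Defensive.
Import Order.TTheory GRing.Theory.
Local Open Scope ring_scope.

(* In fact dim N_l = trdeg Lambda_l' + 1 for all l and l'. Put                  *)
(* w = Omega^-n and u = (t - theta)^-n, so that sigma w = u w and               *)
(* sigma L_j = u L_j + b_j with b_j in E. Applying sigma to a linear relation   *)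
(* shows that the linear independence of 1, w and some of the L_j does not      *)
(* depend on the component l, so it suffices to show that linear independence   *)
(* of 1, w, L_1, ..., L_m over E implies algebraic independence of              *)
(* x = (w, L_1, ..., L_m). The d-th iterate tau of sigma acts on the field L_l  *)
(* with fixed field F. Let P be a relation of minimal leading monomial, monic,  *)
(* of degree D. Minimality makes P(uX + b) with twisted coefficients equal to   *)
(* u^D P, whence the coefficients of P(x + w Z e_j) / w^D are fixed by tau. So  *)
(* every Hasse derivative of positive order a of P in one variable takes at x   *)
(* a value in F w^(D - a), and by minimality it is the polynomial               *)
(* q X_0^(D - a). Hence P is an additive polynomial plus a constant, pure of    *)
(* degree D with D a power of the characteristic exponent, and separability of  *)
(* L over E turns P(x) = 0 into a linear relation between 1, w and the L_j.     *)

(** * Hasse derivatives and affine substitutions *)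

(** Both numbers are read off from one list of indices [J], the same for every component: 1, w and
    the L_j with j in [J] form a basis of N_l over E ([dimension_N]), and w together with these L_j
    is a transcendence basis of Lambda_l over E ([trdeg_Lambda]). The two counts differ by one
    because of the constant 1, and l, l' may differ because sigma carries linear relations around
    the cycle of components ([indep_shift], [basis_exists_all]).

    The substance is that linear independence together with 1 forces algebraic independence
    ([indep_algebraically_independent]). From an arbitrary algebraic relation, [affine_relation]
    extracts one of the form sum of c_j x_j^D plus a constant, with D a power of the characteristic
    exponent; [frobenius_independent] then kills all c_j by separability. Steinitz exchange
    ([acls_steinitz]) and dual functionals ([dual_functional]) supply the field theory and the
    linear algebra. *)

Lemma rmorph_mmap (n : nat) (R : nzRingType) (S S' : nzRingType)
    (phi : {rmorphism S -> S'}) (f : {rmorphism R -> S}) (h : 'I_n -> S)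
    (p : {mpoly R[n]}) :
  phi (mmap f h p) = mmap (phi \o f) (phi \o h) p.
Proof.
rewrite /mmap rmorph_sum; apply: eq_bigr => m _; rewrite rmorphM /=; congr (_ * _).
by rewrite /mmap1 rmorph_prod; apply: eq_bigr => i _; rewrite rmorphXn.
Qed.

Lemma eq_mmap (n : nat) (R S : nzRingType) (f f' : R -> S) (h h' : 'I_n -> S)
    (p : {mpoly R[n]}) :
  f =1 f' -> h =1 h' -> mmap f h p = mmap f' h' p.
Proof.
by move=> ff hh; apply: eq_bigr => m _; rewrite ff; congr (_ * _); apply: mmap1_eq.
Qed.

Lemma mmap_map_mpoly (n : nat) (R R' : nzRingType) (S : comNzRingType) (g : {rmorphism R -> R'})
    (f : {rmorphism R' -> S}) (h : 'I_n -> S) (p : {mpoly R[n]}) :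
  mmap f h (map_mpoly g p) = mmap (f \o g) h p.
Proof.
rewrite /map_mpoly /= rmorph_mmap; apply: eq_mmap => [c|a] /=.
  by rewrite mmapC.
by rewrite mmapX mmap1U.
Qed.

Lemma mmap_comp_mpolyC (n k : nat) (R : comNzRingType) (S : comNzRingType) 
    (f : {rmorphism R -> S}) (h : 'I_k -> S) (g : 'I_n -> {mpoly R[k]}) (p : {mpoly R[n]}) :
  mmap f h (mmap (@mpolyC k R) g p) = mmap f (fun a => mmap f h (g a)) p.
Proof. by rewrite rmorph_mmap; apply: eq_mmap => [c|a] //=; rewrite mmapC. Qed.

Section Hasse.
Variables (n : nat) (R : comNzRingType).
Implicit Types (p : {mpoly R[n]}) (j : 'I_n) (m : 'X_{1..n}).

Definition hasse j a p : {mpoly R[n]} :=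
  \sum_(m <- msupp p) (p@_m *+ 'C(m j, a)) *: 'X_[m - U_(j) *+ a].

Lemma mcoeff_hasse j a p m :
  (hasse j a p)@_m = p@_(m + U_(j) *+ a)%MM *+ 'C(m j + a, a).
Proof.
rewrite raddf_sum /=; set m' := (m + _)%MM.
have m'j : m' j = (m j + a)%N by rewrite mnmDE mulmnE mnm1E eqxx mul1n.
have eqm k : (k - U_(j) *+ a == m)%MM -> (a <= k j)%N -> k = m'.
  move=> /eqP E ak; apply/mnmP => b; rewrite /m' -E !mnmDE mnmBE !mulmnE mnm1E.
  by case: eqP => [<-|_]; rewrite ?mul1n ?mul0n ?subn0 ?addn0 ?subnK.
have mE : (m' - U_(j) *+ a == m)%MM.
  by apply/eqP/mnmP => b; rewrite /m' mnmBE mnmDE addnK.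
have [supp|nsupp] := boolP (m' \in msupp p).
  rewrite (bigD1_seq m') ?msupp_uniq //= mcoeffZ mcoeffX mE mulr1 m'j.
  rewrite big1 ?addr0 // => k neq_k; rewrite mcoeffZ mcoeffX.
  case: eqP => [/eqP E|_]; last by rewrite mulr0.
  have [ak|ka] := leqP a (k j); first by rewrite (eqm k E ak) eqxx in neq_k.
  by rewrite bin_small // mulr0n mul0r.
rewrite (memN_msupp_eq0 nsupp) mul0rn big1_seq // => k /andP[_ ksupp].
rewrite mcoeffZ mcoeffX; case: eqP => [/eqP E|_]; last by rewrite mulr0.
have [ak|ka] := leqP a (k j); first by rewrite -(eqm k E ak) ksupp in nsupp.
by rewrite bin_small // mulr0n mul0r.
Qed.

Lemma msize_hasse j a p : (msize (hasse j a p) <= msize p - a)%N.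
Proof.
rewrite msizeE; apply/bigmax_leqP_seq => m; rewrite mcoeff_msupp mcoeff_hasse => nz _.
have : (m + U_(j) *+ a)%MM \in msupp p.
  by rewrite mcoeff_msupp; apply: contra nz => /eqP ->; rewrite mul0rn.
by move=> /msize_mdeg_lt; rewrite mdegD mdegMn mdeg1 mul1n ltn_subRL addnC.
Qed.

(** Taylor's formula along one axis: for each monomial, expand (x_j + w Z)^(m j) by the binomial
    theorem, the other factors being constant in Z. *)
Lemma coef_mmap_shift (S : comNzRingType) (f : {rmorphism R -> S}) (x : 'I_n -> S) (w : S) j p a :
  (mmap (polyC \o f) (fun b => (x b)%:P + (b == j)%:R * (w *: 'X)) p)`_a =
  w ^+ a * mmap f x (hasse j a p).
Proof.
rewrite /hasse [mmap f x _]raddf_sum /= mulr_sumr coef_sum.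
apply: eq_bigr => m _; rewrite mmapZ mmapX /= coefCM rmorphMn /=.
suff -> : (mmap1 (fun b => (x b)%:P + (b == j)%:R * (w *: 'X)) m)`_a =
    w ^+ a * mmap1 x (m - U_(j) *+ a)%MM *+ 'C(m j, a).
  by rewrite mulrCA -mulrnAr !mulrnAl !mulrnAr.
rewrite /mmap1 (bigD1 j) //= [in RHS](bigD1 j) //= eqxx mul1r.
rewrite (eq_bigr (fun b => (x b ^+ m b)%:P)) => [|b /negPf->]; last first.
  by rewrite mul0r addr0 -polyC_exp.
rewrite -rmorph_prod coefMC.
rewrite [X in _ = _ * (_ * X) *+ _](eq_bigr (fun b => x b ^+ m b)) => [|b nb]; last first.
  by rewrite mnmBE mulmnE mnm1E eq_sym (negPf nb) mul0n subn0.
rewrite mulrA -mulrnAl; congr (_ * _).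
rewrite mnmBE mulmnE mnm1E eqxx mul1n exprDn coef_sum.
under eq_bigr => b _ do
  rewrite exprZn -polyC_exp -mulrnAr coefCM coefMn coefZ coefXn.
have [lea|gta] := leqP a (m j); last first.
  rewrite bin_small // mulr0n big1 // => b _.
  case: eqP => [E|_]; last by rewrite mulr0 mul0rn mulr0.
  by have := ltn_ord b; rewrite -E ltnS leqNgt gta.
pose a' : 'I_(m j).+1 := Ordinal (lea : (a < (m j).+1)%N).
rewrite (bigD1 a') //= eqxx mulr1 big1 => [|b nb].
  by rewrite addr0 mulrnAr mulrC.
have /negPf-> : a != b by apply: contraNneq nb => E; apply/eqP/val_inj.
by rewrite mulr0 mul0rn mulr0.
Qed.
End Hasse.

Section AffineSubst.
Variables (n : nat) (R : idomainType) (u : R) (beta : 'I_n -> R).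

Definition affine_subst (p : {mpoly R[n]}) : {mpoly R[n]} :=
  mmap (@mpolyC n R) (fun a => u *: 'X_a + (beta a)%:MP) p.

(** The substitution only rescales the form of top degree. As [msize] is the degree plus one, the
    bound says that the difference has degree below [mdeg m]. *)
Lemma msize_affine_monomial (m : 'X_{1..n}) :
  (msize (mmap1 (fun a => u *: 'X_a + (beta a)%:MP)%R m
          - u ^+ mdeg m *: 'X_[m])%R <= mdeg m)%N.
Proof.
(* [good A B d]: both have degree at most d and the same form of degree d. This is stable under
   products, so it is enough to check it on the affine factors. *)
pose good (A B : {mpoly R[n]}) d :=
  [/\ msize A <= d.+1, msize B <= d.+1 & msize (A - B)%R <= d]%N.
suff [] : good (mmap1 (fun a => u *: 'X_a + (beta a)%:MP) m)
  (u ^+ mdeg m *: 'X_[m]) (mdeg m) by [].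
have goodM A B d A' B' d' : good A B d -> good A' B' d' ->
    good (A * A') (B * B') (d + d')%N.
  move=> [sA sB sAB] [sA' sB' sAB'].
  have sM (p q : {mpoly R[n]}) a b c :
      (msize p <= a -> msize q <= b -> a + b <= c.+1 -> msize (p * q)%R <= c)%N.
    move=> pa qb abc; have [->|p0] := eqVneq p 0; first by rewrite mul0r msize0.
    have [->|q0] := eqVneq q 0; first by rewrite mulr0 msize0.
    by rewrite msizeM //; lia.
  split; [apply: sM sA sA' _; lia | apply: sM sB sB' _; lia |].
  have -> : A * A' - B * B' = A * (A' - B') + (A - B) * B'.
    by rewrite mulrBr mulrBl addrA subrK.
  rewrite (leq_trans (msizeD_le _ _)) // geq_max; apply/andP; split.
    by apply: sM sA sAB' _; lia.
  by apply: sM sAB sB' _; lia.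
have good1 : good 1 1 0%N by rewrite /good msize1 subrr msize0.
have goodX A B d e : good A B d -> good (A ^+ e) (B ^+ e) (d * e)%N.
  move=> gAB; elim: e => [|e IH]; first by rewrite muln0 !expr0.
  by rewrite mulnS !exprS; apply: goodM.
have -> : u ^+ mdeg m *: 'X_[m] = \prod_(a < n) (u *: 'X_a) ^+ m a :> {mpoly R[n]}.
  rewrite mdegE (mpolyXE_id _ m) -prodrXr.
  under [RHS]eq_bigr => a _ do rewrite exprZn -mul_mpolyC.
  by rewrite big_split /= -rmorph_prod /= mul_mpolyC.
rewrite mdegE /mmap1; elim/big_rec3: _ => // a B A d _ gAB.
apply: goodM gAB; rewrite -[X in good _ _ X]mul1n; apply: goodX.
split; rewrite ?msizeC.
- rewrite (leq_trans (msizeD_le _ _)) // geq_max (leq_trans (msizeZ_le _ _)) ?msizeX ?mdeg1 //=.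
  by rewrite msizeC; case: (_ != _).
- by rewrite (leq_trans (msizeZ_le _ _)) ?msizeX ?mdeg1.
- by rewrite addrC addKr msizeC; case: (_ != _).
Qed.

Lemma mcoeff_affine_subst p m : (msize p <= (mdeg m).+1)%N ->
  (affine_subst p)@_m = u ^+ mdeg m * p@_m.
Proof.
move=> sp; rewrite {1}/affine_subst /mmap raddf_sum /=.
transitivity (\sum_(k <- msupp p) p@_k * (u ^+ mdeg k * (k == m)%:R)).
  apply: eq_big_seq => k ks; rewrite mcoeffCM; congr (_ * _).
  apply/eqP; rewrite -subr_eq0 -mcoeffX -mcoeffZ -mcoeffB; apply/eqP/memN_msupp_eq0.
  apply: msize_mdeg_ge; apply: leq_trans (msize_affine_monomial k) _.
  by rewrite -ltnS (leq_trans (msize_mdeg_lt ks)).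
have [ms|nms] := boolP (m \in msupp p).
  rewrite (bigD1_seq m) ?msupp_uniq //= eqxx mulr1 mulrC big1 ?addr0 //.
  by move=> k /negPf->; rewrite !mulr0.
rewrite (memN_msupp_eq0 nms) mulr0 big1_seq // => k /andP[_ ks].
by case: eqP => [E|_]; rewrite ?mulr0 // -E ks in nms *.
Qed.
End AffineSubst.

(** * Minimal algebraic relations *)

(** The conclusion says that D is a power of the characteristic exponent. Otherwise D = q s with q
    the exact power of p in D and s > 1 prime to p; the coefficient of X^q in (X + 1)^D = (X^q +
    1)^s is then s, which is nonzero in E. *)
Lemma pnat_pchar_bin (E : fieldType) (D : nat) : (0 < D)%N ->
  (forall a, (0 < a < D)%N -> 'C(D, a)%:R = 0 :> E) -> [pchar E].-nat D.
Proof.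
move=> D_gt0 binD; have [D1|D_gt1] := leqP D 1.
  by have -> : D = 1%N by lia.
(* D is itself the binomial coefficient at a = 1, so it vanishes in E and the characteristic is
   positive. *)
have [||p charEp] := @natf0_pchar E D => //.
  by rewrite -(binD 1%N) ?bin1.
have p_pr := pcharf_prime charEp.
have [s ps def_D] := pfactor_coprime p_pr D_gt0.
set q := (p ^ logn p D)%N in def_D.
have q_gt0 : (0 < q)%N by rewrite expn_gt0 prime_gt0.
have s_gt0 : (0 < s)%N by move: D_gt0; rewrite def_D muln_gt0 => /andP[].
have qE : [pchar E].-nat q by rewrite (eq_pnat _ (pcharf_eq charEp)) pnatX pnat_id.
have [s1|s_gt1] := leqP s 1.
  by rewrite def_D (_ : s = 1%N) ?mul1n //; lia.
have qEX : [pchar {poly E}].-nat q.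
  by rewrite (eq_pnat _ (pchar_poly E)).
have /(congr1 (fun f : {poly E} => f`_q)) :
    ('X + 1 : {poly E}) ^+ D = ('X^q + 1) ^+ s.
  by rewrite def_D mulnC exprM exprDn_pchar // expr1n.
rewrite !exprD1n !coef_sum.
have qD : (q < D.+1)%N by rewrite ltnS def_D leq_pmull.
rewrite (bigD1 (Ordinal qD)) //= coefMn coefXn eqxx big1 ?addr0; last first.
  move=> b nb; rewrite coefMn coefXn.
  have /negPf-> : q != b by apply: contraNneq nb => E'; apply/eqP/val_inj.
  by rewrite mul0rn.
rewrite binD; last by rewrite q_gt0 def_D ltn_Pmull.
have s1' : (1 < s.+1)%N by [].
rewrite (bigD1 (Ordinal s1')) //= expr1 coefMn coefXn eqxx big1 ?addr0; last first.
  move=> b nb; rewrite -exprM coefMn coefXn.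
  have /negPf-> : q != (q * b)%N.
    apply: contraNneq nb => E'; apply/eqP/val_inj => /=.
    by apply/eqP; rewrite -(eqn_pmul2l q_gt0) -E' muln1.
  by rewrite mul0rn.
move/esym/eqP; rewrite bin1 -(dvdn_pcharf charEp) => p_s.
by move: ps; rewrite prime_coprime // p_s.
Qed.

Lemma mulmnDr (n : nat) (m : 'X_{1..n}) (a b : nat) :
  (m *+ a + m *+ b = m *+ (a + b))%MM.
Proof. by apply/mnmP => j; rewrite mnmDE !mulmnE mulnDr. Qed.

Section AffineRelation.
Variables (E K : fieldType) (i : {rmorphism E -> K}).
Variables (s : {rmorphism E -> E}) (tau : {rmorphism K -> K}).
Hypothesis tau_i : forall a, tau (i a) = i (s a).
Hypothesis tau_fixed : forall x, tau x = x -> exists a, x = i a.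
Variables (N : nat) (x : 'I_N -> K) (o : 'I_N) (u : E) (beta : 'I_N -> E).
Hypothesis u_neq0 : u != 0.
Hypothesis tau_x : forall a, tau (x a) = i u * x a + i (beta a).
Hypothesis beta_o : beta o = 0.
Hypothesis x_transc : ~ algebraicOver i (x o).

Section MinimalRelation.
Variable P : {mpoly E[N]}.
Hypothesis Px0 : mmap i x P = 0.
Hypothesis P_monic : mleadc P = 1.
Hypothesis P_min :
  forall Q, mmap i x Q = 0 -> Q != 0 -> ~ (mlead Q < mlead P)%O.
Local Notation D := (mdeg (mlead P)).

Let P_neq0 : P != 0.
Proof. by rewrite -mleadc_eq0 P_monic oner_eq0. Qed.

Let sP : msize P = D.+1. Proof. by rewrite mlead_deg. Qed.

(** The monomial order refines the degree, so a nonzero relation of degree below D would have a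
    smaller leading monomial than [P]. *)
Let mlead_small (Q : {mpoly E[N]}) : mmap i x Q = 0 -> (msize Q <= D)%N -> Q = 0.
Proof.
move=> Q0 sQ; apply/eqP/negPn/negP => Qn0; apply: (P_min Q0 Qn0).
by apply: lt_mdeg_ltmc; rewrite mlead_deg.
Qed.

(** The difference of the two sides vanishes at [x], as seen by applying [tau] to P(x) = 0. The
    leading terms cancel because [P] is monic, and any other monomial of degree at least D comes
    from the support of [P]; minimality leaves only zero. *)
Let P_semi_invariant : affine_subst u beta (map_mpoly s P) = u ^+ D *: P.
Proof.
apply/eqP; rewrite -subr_eq0; apply/negPn/negP => Qn0.
set Q := _ - _ in Qn0; apply: (P_min _ Qn0).
  rewrite /Q mmapB mmapZ Px0 mulr0 subr0 /affine_subst mmap_comp_mpolyC mmap_map_mpoly.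
  rewrite -[RHS](rmorph0 tau) -Px0 rmorph_mmap; apply: eq_mmap => a /=.
    by rewrite tau_i.
  by rewrite mmapD mmapZ mmapC mmapX mmap1U tau_x.
have Qm m : (D <= mdeg m)%N -> Q@_m = u ^+ mdeg m * (s P@_m) - u ^+ D * P@_m.
  move=> Dm; rewrite mcoeffB mcoeffZ mcoeff_affine_subst ?mcoeff_map_mpoly //.
  apply: leq_trans (_ : D.+1 <= _)%N; last by [].
  rewrite -sP; apply/bigmax_leqP_seq => k; rewrite mcoeff_msupp mcoeff_map_mpoly => nz _.
  by apply: msize_mdeg_lt; rewrite mcoeff_msupp; apply: contra nz => /eqP->; rewrite raddf0.
have := mleadc_eq0 Q; rewrite (negPf Qn0) => /negbT nz.
have [/lt_mdeg_ltmc //|Dm] := ltnP (mdeg (mlead Q)) D.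
rewrite Qm // in nz; rewrite lt_neqAle; apply/andP; split.
  by apply: contraNneq nz => ->; rewrite P_monic rmorph1 subrr.
apply: msupp_le_mlead; rewrite mcoeff_msupp; apply: contra nz => /eqP->.
by rewrite rmorph0 !mulr0 subrr.
Qed.

Let xo_neq0 : x o != 0.
Proof. by apply/eqP => x0; apply: x_transc; rewrite x0; apply: algebraic0. Qed.

(* The coefficients of P(x + x_o Z e_j) / x_o^D are fixed by tau, since         *)
(* tau (x + x_o Z e_j) = u (x + x_o Z e_j) + beta.                              *)
Let hasse_value j a : exists q, x o ^+ a * mmap i x (hasse j a P) = i q * x o ^+ D.
Proof.
rewrite -coef_mmap_shift.
pose g b : {poly K} := (x b)%:P + (b == j)%:R * (x o *: 'X).
rewrite -/g; set G := mmap _ g P.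
have tG : map_poly tau G = (i u ^+ D)%:P * G.
  rewrite rmorph_mmap -[in RHS]rmorphXn -[(i _)%:P]/((polyC \o i) _) -mmapZ -P_semi_invariant.
  rewrite /affine_subst mmap_comp_mpolyC mmap_map_mpoly; apply: eq_mmap => b /=.
    by rewrite map_polyC /= tau_i.
  rewrite mmapD mmapZ mmapC mmapX mmap1U /= /g rmorphD rmorphM rmorph_nat /=.
  rewrite map_polyC linearZ /= map_polyX !tau_x beta_o rmorph0 addr0.
  by rewrite polyCD polyCM -!mul_polyC polyCM; ring.
have [|q Eq] := @tau_fixed (G`_a / x o ^+ D).
  rewrite fmorph_div rmorphXn tau_x beta_o rmorph0 addr0 -coef_map tG coefCM.
  by rewrite exprMn -mulf_div divff ?mul1r // expf_neq0 // fmorph_eq0.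
by exists q; rewrite -Eq divfK // expf_neq0.
Qed.

(** By [hasse_value] both sides agree at [x]. Both have degree at most D - a < D, so [mlead_small]
    turns equal values into equal polynomials. *)
Let hasse_const j a : (0 < a <= D)%N ->
  exists q, hasse j a P = q *: 'X_[U_(o) *+ (D - a)].
Proof.
move=> /andP[a_gt0 aD]; have [q Eq] := hasse_value j a; exists q.
apply/eqP; rewrite -subr_eq0; apply/eqP/mlead_small.
  apply/(mulfI (expf_neq0 a xo_neq0)); rewrite mmapB mmapZ mmapX mulr0 mulrBr Eq.
  rewrite mulrCA /mmap1 (bigD1 o) //= mulmnE mnm1E eqxx mul1n big1 ?mulr1.
    by rewrite -exprD subnKC // subrr.
  by move=> b; rewrite eq_sym mulmnE mnm1E => /negPf->; rewrite expr0.
apply: leq_trans (msizeD_le _ _) _; rewrite msizeN geq_max; apply/andP; split.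
  by apply: leq_trans (msize_hasse _ _ _) _; rewrite sP; lia.
apply: leq_trans (msizeZ_le _ _) _; rewrite msizeX mdegMn mdeg1 mul1n; lia.
Qed.

Let D_gt0 : (0 < D)%N.
Proof.
rewrite lt0n; apply/eqP => D0; have := msize1_polyC (_ : msize P <= 1)%N.
rewrite sP D0 => /(_ isT) EP; move: Px0; rewrite EP mmapC => /eqP.
by rewrite fmorph_eq0 => /eqP P0; move: P_neq0; rewrite EP P0 mpolyC0 eqxx.
Qed.

Let supp_le m : P@_m != 0 -> (mdeg m <= D)%N.
Proof. by rewrite -mcoeff_msupp => /msize_mdeg_lt; rewrite sP. Qed.

(** Take the derivative of order exactly [m j] in the variable [j]: the binomial is then 1, so the
    monomial survives, and [hasse_const] forces what is left of it to be a power of X_o. *)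
Let supp_shape m j : P@_m != 0 -> (0 < m j)%N ->
  m = (U_(j) *+ m j + U_(o) *+ (D - m j))%MM.
Proof.
move=> nz mj; have mD := supp_le nz.
have mjD : (m j <= D)%N by apply: leq_trans mD; rewrite mdegE (bigD1 j) //= leq_addr.
have [|q Eq] := @hasse_const j (m j); first by rewrite mj.
set A := (m - U_(j) *+ m j)%MM.
have EA : (A + U_(j) *+ m j)%MM = m.
  apply/mnmP => b; rewrite mnmDE mnmBE mulmnE mnm1E.
  by case: eqP => [<-|_]; rewrite ?mul1n ?subnK // mul0n subn0 addn0.
have := congr1 (mcoeff A) Eq; rewrite mcoeff_hasse EA.
have -> : A j = 0%N by rewrite mnmBE mulmnE mnm1E eqxx mul1n subnn.
rewrite add0n binn mulr1n mcoeffZ mcoeffX; case: eqP => [E0 _|_ E0].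
  by rewrite E0 addmC.
by rewrite E0 mulr0 eqxx in nz.
Qed.

(** If X_o occurs, [supp_shape] with j = o leaves only X_o^D. If not, the factor X_o^(D - m j) must
    be trivial, so m j = D. *)
Let supp_pure m : P@_m != 0 -> m != 0%MM -> exists j, m = (U_(j) *+ D)%MM.
Proof.
move=> nz m0; have [mo|mo] := posnP (m o); last first.
  exists o; rewrite [LHS](supp_shape nz mo) mulmnDr subnKC //.
  by apply: leq_trans (supp_le nz); rewrite mdegE (bigD1 o) //= leq_addr.
have [j mj] : exists j, (0 < m j)%N.
  apply/existsP; apply: contraNT m0; rewrite negb_exists => /forallP m0.
  by apply/eqP/mnmP => b; rewrite mnm0E; apply/eqP; rewrite -leqn0 leqNgt.
have := supp_shape nz mj => Em; exists j.
have jo : j != o by apply: contraTneq mj => ->; rewrite mo.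
have := congr1 (fun k : 'X_{1..N} => k o) Em.
rewrite mo mnmDE !mulmnE !mnm1E eqxx (negPf jo) mul0n mul1n add0n => /esym/eqP.
rewrite subn_eq0 => Dm; rewrite [LHS]Em (eqP (_ : D - m j == 0)%N) ?subn_eq0 //.
rewrite mulm0n addm0; congr (_ *+ _)%MM; apply/eqP; rewrite eqn_leq Dm.
by rewrite (leq_trans _ (supp_le nz)) // mdegE (bigD1 j) //= leq_addr.
Qed.

(** [supp_pure] makes [P] a combination of the X_j^D plus a constant. A derivative in some X_j other
    than X_o then shows that the intermediate binomials of D vanish in E. *)
Lemma minimal_relation : exists D (c : 'I_N -> E) e,
  [/\ [pchar E].-nat D, \sum_j i (c j) * x j ^+ D + i e = 0 & exists j, c j != 0].
Proof.
pose c j := P@_(U_(j) *+ D)%MM; pose e := P@_0%MM.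
have inj j k : (U_(j) *+ D == U_(k) *+ D :> 'X_{1..N})%MM = (j == k).
  apply/eqP/eqP => [/(congr1 (fun m : 'X_{1..N} => m j))|-> //].
  by rewrite !mulmnE !mnm1E eqxx mul1n; case: eqP => // _; lia.
have UD0 j : (U_(j) *+ D == 0 :> 'X_{1..N})%MM = false.
  by rewrite -mdeg_eq0 mdegMn mdeg1 mul1n; apply/negbTE; rewrite -lt0n.
have EP : P = \sum_j c j *: 'X_[U_(j) *+ D] + e%:MP.
  apply/mpolyP => m; rewrite mcoeffD raddf_sum mcoeffC /=.
  under eq_bigr => j _ do rewrite mcoeffZ mcoeffX.
  have [<-|m0] := eqVneq 0%MM m.
    by rewrite mulr1 big1 ?add0r // => j _; rewrite UD0 mulr0.
  rewrite mulr0 addr0; have [Pm0|nz] := eqVneq (P@_m) 0.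
    by rewrite big1 // => j _; case: eqP => [E'|]; rewrite ?mulr0 // /c E' Pm0 mul0r.
  have [|k ->] := supp_pure nz; first by rewrite eq_sym.
  rewrite (bigD1 k) //= eqxx mulr1 big1 ?addr0 // => j /negPf jk.
  by rewrite inj jk mulr0.
have rel : \sum_j i (c j) * x j ^+ D + i e = 0.
  transitivity (mmap i x P) => //; rewrite [in RHS]EP mmapD mmapC raddf_sum /=; congr (_ + _).
  apply: eq_bigr => j _; rewrite mmapZ mmapX; congr (_ * _).
  rewrite /mmap1 (bigD1 j) //= mulmnE mnm1E eqxx mul1n big1 ?mulr1 //.
  by move=> b; rewrite eq_sym mulmnE mnm1E => /negPf->; rewrite expr0.
(* If only X_o occurred, the relation would make x_o algebraic or [P] zero. *)
have [j0 jo cj0] : exists2 j, j != o & c j != 0.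
  apply: contrapT => nex.
  have c0 j : j != o -> c j = 0.
    by move=> jo; apply/eqP/negPn/negP => cj; apply: nex; exists j.
  move: rel; rewrite (bigD1 o) //= big1 ?addr0 => [rel|j /c0->]; last first.
    by rewrite rmorph0 mul0r.
  have [co|co] := eqVneq (c o) 0.
    move: rel P_neq0; rewrite EP co rmorph0 mul0r add0r => /eqP.
    rewrite fmorph_eq0 => /eqP->; rewrite big1 ?addr0 ?eqxx // => j _.
    by have [->|/c0->] := eqVneq j o; rewrite ?co scale0r.
  apply: x_transc; exists (c o *: 'X^D + e%:P).
    apply/eqP => /(congr1 (fun f : {poly E} => f`_D)).
    rewrite coefD coefZ coefXn eqxx mulr1 coefC coef0 (gtn_eqF D_gt0) addr0.
    by apply/eqP.
  by rewrite rootE rmorphD /= map_polyZ map_polyXn map_polyC /= !hornerE rel.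
exists D, c, e; split=> //; last by exists j0.
apply: pnat_pchar_bin => // a /andP[a0 aD].
(* The derivative of c X_j0^D is a multiple of X_j0^(D - a), while [hasse_const] allows only powers
   of X_o; hence the binomial coefficient times c is 0. *)
have [|q Eq] := @hasse_const j0 a; first by rewrite a0 ltnW.
have := congr1 (mcoeff (U_(j0) *+ (D - a))%MM) Eq.
rewrite mcoeff_hasse mulmnDr subnK ?(ltnW aD) // mulmnE mnm1E eqxx mul1n.
rewrite subnK ?(ltnW aD) // mcoeffZ mcoeffX.
have /negPf-> : (U_(o) *+ (D - a) != U_(j0) *+ (D - a) :> 'X_{1..N})%MM.
  apply/eqP => /(congr1 (fun m : 'X_{1..N} => m o)).
  by rewrite !mulmnE !mnm1E eqxx (negPf jo); lia.
by rewrite mulr0 => E0; apply: (mulfI cj0); rewrite mulr0 mulr_natr.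
Qed.
End MinimalRelation.

(** Descent along the well-founded monomial order reaches a minimal relation, which is made monic.
    In the application [tau] is the d-th iterate of sigma on L_l and [o] is the index of w. *)
Lemma affine_relation (P : {mpoly E[N]}) : P != 0 -> mmap i x P = 0 ->
  exists D (c : 'I_N -> E) e,
  [/\ [pchar E].-nat D, \sum_j i (c j) * x j ^+ D + i e = 0 & exists j, c j != 0].
Proof.
elim/mleadrect: P => P IH P0 Px0.
have [[Q [Qx0 Q0 QP]]|nex] := pselect (exists Q,
    [/\ mmap i x Q = 0, Q != 0 & (mlead Q < mlead P)%O]).
  exact: IH QP Q0 Qx0.
have lc : mleadc P != 0 by rewrite mleadc_eq0.
have lead : mlead ((mleadc P)^-1 *: P) = mlead P by rewrite mleadZ // invr_eq0.
apply: (@minimal_relation ((mleadc P)^-1 *: P)).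
- by rewrite mmapZ Px0 mulr0.
- by rewrite lead mcoeffZ mulVf.
- by move=> Q Qx0 Q0; rewrite lead => QP; apply: nex; exists Q.
Qed.
End AffineRelation.

(** * Separability *)

Section LinearFunctional.
Variables (k K : fieldType) (i : {rmorphism k -> K}).

Definition subspace (W : K -> Prop) :=
  W 0 /\ forall c a b, W a -> W b -> W (i c * a + b).

Definition functional (f : K -> k) := forall c a b, f (i c * a + b) = c * f a + f b.

(** Zorn gives a maximal subspace A containing W and avoiding v. Then K is the direct sum of A and
    the line of v, and f is the coordinate along v. *)
Lemma separating_functional (W : K -> Prop) (v : K) : subspace W -> ~ W v ->
  exists f, [/\ functional f, f v = 1 & forall w, W w -> f w = 0].
Proof.
move=> [W0 WD] Wv.
(* Containment of W is required only of nonempty A, since the union of the empty chain is empty.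
   Maximality against W itself later excludes the empty set. *)
pose good (A : set K) := [/\ forall c a b, A a -> A b -> A (i c * a + b),
  ~ A v & forall a, A a -> forall w, W w -> A w].
have [|A [[AD Av AW] Amax]] := @Zorn_bigcup K good.
  move=> F Fgood Ftot; split.
  - move=> c a b [X FX Xa] [Y FY Yb].
    have [XY|YX] := Ftot X Y FX FY.
      by exists Y => //; have [YD _ _] := Fgood Y FY; apply: YD => //; apply: XY.
    by exists X => //; have [XD _ _] := Fgood X FX; apply: XD => //; apply: YX.
  - by move=> [X FX Xv]; have [_ nXv _] := Fgood X FX.
  - move=> a [X FX Xa] w Ww; exists X => //.
    by have [_ _ XW] := Fgood X FX; apply: XW Xa w Ww.
have {}AW w : W w -> A w.
  move=> Ww; have [[a Aa]|nA] := pselect (exists a, A a); first exact: AW Aa w Ww.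
  have [] := Amax W; last by split.
  by split=> [a Aa|/(_ 0 W0) A0]; case: nA; [exists a | exists 0].
have A0 : A 0 by exact: AW.
have AZ c a : A a -> A (i c * a) by move=> Aa; rewrite -[_ * _]addr0; apply: AD.
have AB a b : A a -> A b -> A (a - b).
  by move=> Aa Ab; rewrite addrC -mulN1r -(rmorphN1 i); apply: AD.
(* For w outside A, the subspace A + k w is strictly larger, so it must contain v; solving for w
   gives the coordinate. *)
have Aex w : exists c, A (w - i c * v).
  have [Aw|nAw] := pselect (A w); first by exists 0; rewrite rmorph0 mul0r subr0.
  pose B : set K := [set z | exists c, A (z - i c * w)]%classic.
  have [[c Ac]|nBv] := pselect (B v).
    have c0 : c != 0.
      by apply/eqP => c0; apply: Av; rewrite c0 rmorph0 mul0r subr0 in Ac.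
    exists c^-1; have -> : w - i c^-1 * v = i (- c^-1) * (v - i c * w).
      by rewrite rmorphN fmorphV; field; rewrite fmorph_eq0.
    exact: AZ.
  have AsubB z : A z -> B z by exists 0; rewrite rmorph0 mul0r subr0.
  have [] := Amax B; last first.
    split=> // [c a b [ca Aa] [cb Ab]|a _ z /AW/AsubB //].
    exists (c * ca + cb); have -> : i c * a + b - i (c * ca + cb) * w =
        i c * (a - i ca * w) + (b - i cb * w) by rewrite rmorphD rmorphM; ring.
    exact: AD.
  split=> // /(_ w) BA; apply: nAw; apply: BA.
  by exists 1; rewrite rmorph1 mul1r subrr.
have Auniq w c c' : A (w - i c * v) -> A (w - i c' * v) -> c = c'.
  move=> Ac Ac'; apply/eqP; rewrite -subr_eq0; apply/negPn/negP => cc.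
  apply: Av; have -> : v = i (c - c')^-1 * ((w - i c' * v) - (w - i c * v)).
    by rewrite fmorphV rmorphB; field; rewrite -rmorphB fmorph_eq0.
  exact/AZ/AB.
pose f w := sval (cid (Aex w)).
have fP w : A (w - i (f w) * v) by rewrite /f; case: cid.
exists f; split=> [c a b||w Ww].
- apply: Auniq (fP _) _.
  have -> : i c * a + b - i (c * f a + f b) * v =
      i c * (a - i (f a) * v) + (b - i (f b) * v) by rewrite rmorphD rmorphM; ring.
  exact: AD.
- by apply: Auniq (fP _) _; rewrite rmorph1 mul1r subrr.
- by apply: Auniq (fP _) _; rewrite rmorph0 mul0r subr0; apply: AW.
Qed.
End LinearFunctional.

Section Frobenius.
Variables (k : fieldType) (q : nat).
Hypothesis q_pchar : [pchar k].-nat q.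
(** The proof about [q] is an argument so that the morphism structure, whose additivity depends on
    it, can be attached to the map. *)
Definition frob of [pchar k].-nat q := fun a : k => a ^+ q.
Fact frob_zmod : zmod_morphism (frob q_pchar).
Proof.
by move=> a b; apply/eqP; rewrite eq_sym subr_eq -exprDn_pchar // subrK.
Qed.
Fact frob_monoid : monoid_morphism (frob q_pchar).
Proof. by split=> [|a b]; rewrite /frob ?expr1n ?exprMn. Qed.
HB.instance Definition _ := GRing.isZmodMorphism.Build k k (frob q_pchar) frob_zmod.
HB.instance Definition _ := GRing.isMonoidMorphism.Build k k (frob q_pchar) frob_monoid.
End Frobenius.

(** This is the map f (x) id to k (x)_k B = B, checked on the generators of the congruence. *)
Lemma tensor_eq_eval (k A B : comNzRingType) (i : {rmorphism k -> A})
    (j : {rmorphism k -> B}) (f : A -> k) (s t : seq (A * B)) :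
  (forall c a b, f (i c * a + b) = c * f a + f b) ->
  tensor_eq i j s t ->
  \sum_(x <- s) j (f x.1) * x.2 = \sum_(x <- t) j (f x.1) * x.2.
Proof.
move=> flin.
have f0 : f 0 = 0.
  by have := flin (-1) 0 0; rewrite mulr0 addr0 mulN1r addNr.
elim=> {s t} // [s t u _ -> //|s s' t t' _ E _ E'|s t|b|a a' b|a b b'|c a b].
- by rewrite !big_cat /= E E'.
- by rewrite !big_cat /= addrC.
- by rewrite big_seq1 big_nil f0 rmorph0 mul0r.
- rewrite !big_cons !big_nil !addr0 /= -[a]mul1r -(rmorph1 i) flin rmorph1 !mul1r.
  by rewrite rmorphD mulrDl.
- by rewrite !big_cons !big_nil !addr0 mulrDr.
- rewrite !big_seq1 /= -[_ * a]addr0 flin f0 addr0 rmorphM; ring.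
Qed.

Section SeparableFrobenius.
Local Open Scope quotient_scope.

Lemma pi_tensorE (k A B : comNzRingType) (i : {rmorphism k -> A})
    (j : {rmorphism k -> B}) (s : seq (A * B)) :
  \pi_(tensor i j) s = \sum_(x <- s) pure i j x.1 x.2.
Proof.
elim: s => [|[a b] s IH]; first by rewrite big_nil.
by rewrite big_cons -IH [RHS]tensor_addE.
Qed.

(** Tensor A with k along Frobenius. The element sum of x_j (x) c_j has q-th power (sum of c_j
    x_j^q) (x) 1 = 0, so it vanishes because the tensor product is reduced; applying f (x) id gives
    the claim. *)
Lemma separable_frobenius (k : fieldType) (A : comNzRingType)
    (i : {rmorphism k -> A}) (q m : nat) (x : 'I_m -> A) (c : 'I_m -> k) (f : A -> k) :
  separable_algebra i -> [pchar k].-nat q ->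
  (forall c a b, f (i c * a + b) = c * f a + f b) ->
  \sum_j i (c j) * x j ^+ q = 0 -> \sum_j f (x j) ^+ q * c j = 0.
Proof.
move=> sep q_pchar flin rel; pose j : {rmorphism k -> k} := frob q_pchar.
pose s := [seq (x a, c a) | a <- enum 'I_m].
suff /tensor_piP/(tensor_eq_eval flin) : \pi_(tensor i j) s = \pi_(tensor i j) [::].
  by rewrite big_nil big_map big_enum.
apply: (sep k j _ q).
(* Characteristics are defined only for nonzero rings, so the zero ring is set aside. *)
have [T0|T_neq0] := eqVneq (1 : tensor i j) 0.
  by rewrite -[LHS]mul1r T0 mul0r.
pose T : comNzRingType := HB.pack (tensor i j)
  (GRing.PzSemiRing_isNonZero.Build (tensor i j) T_neq0).
have pT : [pchar T].-nat q.
  apply: (sub_in_pnat _ q_pchar) => p _ /andP[p_pr /eqP p0]; apply/andP; split=> //.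
  by apply/eqP; rewrite -(rmorph_nat (tensorl i j)) -(rmorph_nat i) p0 !rmorph0.
have powD : {morph (fun z : tensor i j => z ^+ q) : y z / y + z}.
  by move=> y z; apply: (@exprDn_pchar T).
have q_gt0 : (0 < q)%N by case/andP: (q_pchar).
have powE a b e : pure i j a b ^+ e = pure i j (a ^+ e) (b ^+ e).
  by elim: e => [|e IH]; rewrite ?expr0 // !exprS IH pureM.
rewrite pi_tensorE big_map big_enum /=.
rewrite (big_morph _ powD (_ : 0 ^+ q = 0)) ?expr0n ?(gtn_eqF q_gt0) //.
transitivity (tensorl i j (\sum_j i (c j) * x j ^+ q)); last by rewrite rel rmorph0.
rewrite rmorph_sum; apply: eq_bigr => a _ /=.
by rewrite powE /tensorl pureZ mulr1.
Qed.
End SeparableFrobenius.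

(** * Transcendence degree *)

Lemma nat_such_thatE (P : nat -> Prop) n :
  P n -> (forall m, P m -> m = n) -> nat_such_that P = n.
Proof.
move=> Pn Puniq; rewrite /nat_such_that; case: pselect => [exP|[]]; last by exists n.
by apply: Puniq; case: cid.
Qed.

(** * Generated subfields, relative algebraic closure and Steinitz exchange *)

Section GeneratedSubfieldTheory.
Variables (k K : fieldType) (i : {rmorphism k -> K}).
Implicit Types (S : K -> Prop) (x y z : K).

Lemma gen_subfield_mem S z : S z -> z \in gen_subfield i S.
Proof. by move=> Sz; apply/asboolP => M _ _; apply. Qed.

Lemma gen_subfield_min S (M : K -> Prop) :
  M 1 -> (forall x y, M x -> M y -> M (x - y)) ->
  (forall x y, M x -> M y -> M (x / y)) -> (forall a, M (i a)) ->
  (forall z, S z -> M z) -> forall z, z \in gen_subfield i S -> M z.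
Proof.
move=> M1 MB Mdiv iM SM z /asboolP gz.
suff : z \in ((fun x => `[< M x >]) : {pred K}) by move/asboolP.
apply: gz => [|a|y /SM My]; try exact/asboolP.
split=> [|x y /asboolP Mx /asboolP My|x y /asboolP Mx /asboolP My]; apply/asboolP => //.
  exact: MB.
exact: Mdiv.
Qed.

Lemma gen_subfield_sub S S' z : (forall y, S y -> y \in gen_subfield i S') ->
  z \in gen_subfield i S -> z \in gen_subfield i S'.
Proof.
move=> SS'; apply: (@gen_subfield_min S (fun w => w \in gen_subfield i S')) => //.
- exact: rpred1.
- by move=> *; apply: rpredB.
- by move=> *; apply: rpred_div.
- exact: gen_subfield_base.
Qed.

Lemma gen_subfield_fraction (A : comNzRingType) (ev : {rmorphism A -> K}) S :
  (forall a, exists u, i a = ev u) -> (forall y, S y -> exists u, y = ev u) ->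
  forall z, z \in gen_subfield i S -> exists u v, ev v != 0 /\ z = ev u / ev v.
Proof.
have triv z : (exists u, z = ev u) -> exists u v, ev v != 0 /\ z = ev u / ev v.
  by case=> u ->; exists u, 1; rewrite rmorph1 oner_neq0 divr1.
move=> ev_i ev_S; apply: gen_subfield_min => [|x y|x y|a|y Sy].
- by apply: triv; exists 1; rewrite rmorph1.
- move=> [u [v [v0 ->]]] [u' [v' [v'0 ->]]]; exists (u * v' - u' * v), (v * v').
  by rewrite !(rmorphB, rmorphM) mulf_neq0 //; split=> //; field; rewrite v0 v'0.
- move=> [u [v [v0 ->]]] [u' [v' [v'0 ->]]].
  have [u'0|u'0] := eqVneq (ev u') 0.
    by apply: triv; exists 0; rewrite u'0 mul0r invr0 mulr0 rmorph0.
  exists (u * v'), (v * u'); rewrite !rmorphM mulf_neq0 //; split=> //.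
  by field; rewrite v0 v'0 u'0.
- exact/triv/ev_i.
- exact/triv/ev_S.
Qed.

Lemma clear_denominators (A : comNzRingType) (ev : {rmorphism A -> K}) (p : {poly K}) :
  (forall a, exists u v, ev v != 0 /\ p`_a = ev u / ev v) ->
  exists (q : {poly A}) e, ev e != 0 /\ map_poly ev q = ev e *: p.
Proof.
elim/poly_ind: p => [|p c IH] cp.
  by exists 0, 1; rewrite rmorph0 scaler0 rmorph1 oner_neq0.
have [a|q [e [e0 Eq]]] := IH.
  have [u [v [v0 E]]] := cp a.+1; exists u, v; split=> //.
  by rewrite -E coefD coefMX coefC addr0.
have [u [v [v0 E]]] := cp 0%N; rewrite coefD coefMX coefC add0r /= in E.
exists (v *: q * 'X + (e * u)%:P), (e * v); rewrite rmorphM mulf_neq0 //; split=> //.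
rewrite rmorphD rmorphM /= map_polyX map_polyZ map_polyC /= Eq E.
rewrite scalerDr scalerA [ev v * _]mulrC -scalerAl; congr (_ + _).
by rewrite -mul_polyC -polyCM rmorphM; congr polyC; field.
Qed.

Definition acl S z := algebraicOver (\val : gen_field i S -> K) z.

(** Keeping the polynomial over K and constraining its coefficients avoids changing coefficient
    field whenever S changes. *)
Lemma aclP S z : acl S z <->
  exists p : {poly K}, [/\ p != 0, forall a, p`_a \in gen_subfield i S & root p z].
Proof.
split=> [[p p0 pz]|[p [p0 Sp pz]]].
  exists (map_poly \val p); split=> //; first by rewrite map_poly_eq0.
  by move=> a; rewrite coef_map /=; apply: valP.
pose q := \poly_(a < size p) (Sub p`_a (Sp a) : gen_field i S).
have Eq : map_poly \val q = p.
  apply/polyP => a; rewrite coef_map coef_poly /=.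
  by case: ltnP => // pa; rewrite nth_default.
by exists q; rewrite ?Eq //; apply: contraNneq p0 => q0; rewrite -Eq q0 rmorph0.
Qed.

Lemma acl_gen S z : z \in gen_subfield i S -> acl S z.
Proof. by move=> Sz; apply: (algebraic_id _ (Sub z Sz : gen_field i S)). Qed.

Lemma acl_mem S z : S z -> acl S z.
Proof. by move=> Sz; apply/acl_gen/gen_subfield_mem. Qed.

(** Elements algebraic over k(S') form a field containing k(S), and a root of a nonzero polynomial
    with algebraic coefficients is algebraic. *)
Lemma acl_trans S S' z : (forall y, S y -> acl S' y) -> acl S z -> acl S' z.
Proof.
move=> SS' /aclP[p [p0 Sp pz]]; apply/integral_algebraic.
apply: (integral_root p0 pz) => _ /(nthP 0)[a _ <-]; apply/integral_algebraic.
move: (p`_a) (Sp a); apply: gen_subfield_min SS'.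
- exact: algebraic1.
- by move=> *; apply: algebraic_sub.
- by move=> *; apply: algebraic_div.
- by move=> a'; apply/acl_gen/gen_subfield_base.
Qed.

(** Clearing denominators in an equation for z over k(S, y) gives a bivariate Q over k(S) with Q(y,
    z) = 0. Read it as an equation for y over k(S, z). *)
Lemma acl_exchange S y z :
  acl (fun w => w = y \/ S w) z -> ~ acl S z -> acl (fun w => w = z \/ S w) y.
Proof.
move=> /aclP[p [p0 Sp pz]] nSz.
pose ev : {rmorphism {poly gen_field i S} -> K} :=
  horner_eval y \o map_poly (\val : gen_field i S -> K).
have evE a : ev a = (map_poly (\val : gen_field i S -> K) a).[y] by [].
have [a|q [e [e0 Eq]]] := clear_denominators (ev := ev) (p := p).
  apply: gen_subfield_fraction (Sp a) => [b|w [->|Sw]].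
  - by exists (gen_base i S b)%:P; rewrite evE map_polyC hornerC.
  - by exists 'X; rewrite evE map_polyX hornerX.
  - exists (Sub w (gen_subfield_mem Sw) : gen_field i S)%:P.
    by rewrite evE map_polyC hornerC.
pose Q : {poly {poly K}} := map_poly (map_poly (\val : gen_field i S -> K)) q.
have QE : map_poly (horner_eval y) Q = ev e *: p by rewrite -Eq -map_poly_comp.
have Qcoef a b : Q`_a`_b \in gen_subfield i S by rewrite !coef_map /=; apply: valP.
pose w : {poly K} := Q.[z%:P].
have wE (a : nat) : w`_a = ((swapXY Q)`_a).[z].
  by rewrite /w -[Q]swapXYK horner_swapXY coef_map swapXYK.
(* If Q becomes zero once z is substituted, its leading coefficient in the y-variable is a nonzero
   polynomial over k(S) killing z, against [nSz]. *)
have [w0|w0] := eqVneq w 0; last first.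
  apply/aclP; exists w; split=> // [a|].
    rewrite wE horner_coef; apply: rpred_sum => b _; rewrite coef_swapXY.
    apply: rpredM; last by apply: rpredX; apply: gen_subfield_mem; left.
    by apply: gen_subfield_sub (Qcoef b a) => v Sv; apply: gen_subfield_mem; right.
  rewrite rootE -[_.[_]]/(horner_eval y w) -horner_map /= {2}/horner_eval hornerC.
  by rewrite QE hornerZ (rootP pz) mulr0.
have Q0 : swapXY Q != 0.
  rewrite swapXY_eq0; apply: contra_neq (_ : ev e *: p != 0) => [Q0|].
    by rewrite -QE Q0 rmorph0.
  by rewrite scaler_eq0 negb_or e0.
case: nSz; apply/aclP; exists (lead_coef (swapXY Q)); split.
- by rewrite lead_coef_eq0.
- by move=> a; rewrite lead_coefE coef_swapXY.
- by rewrite rootE lead_coefE -wE w0 coef0.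
Qed.

Definition acls (s : seq K) := acl (fun w => w \in s).

Lemma acls_sub (s t : seq K) z : (forall y, y \in s -> acls t y) -> acls s z -> acls t z.
Proof. exact: acl_trans. Qed.

Lemma acls_split (B t : seq K) z : ~ acls B z -> acls (B ++ t) z ->
  exists t1 y t2, [/\ t = t1 ++ y :: t2, acls (y :: B ++ t1) z & ~ acls (B ++ t1) z].
Proof.
elim: t B => [|y t IH] B nBz; first by rewrite cats0.
rewrite -cat_rcons => tz; have [Bz|/IH /(_ tz)] := pselect (acls (rcons B y) z).
  exists [::], y, t; rewrite cats0; split=> //.
  by apply: acls_sub Bz => w wB; apply: acl_mem; rewrite mem_rcons in wB.
move=> [t1 [y' [t2 [-> yz nz]]]]; exists (y :: t1), y', t2.
by split=> //; rewrite -cat_rcons.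
Qed.

(** Each round moves the head of [s] into [B] and removes from [t] the element y that it replaces;
    [acls_split] finds y as the first entry making the head algebraic. *)
Lemma acls_steinitz (B s t : seq K) :
  (forall m, (m < size s)%N -> ~ acls (B ++ take m s) s`_m) ->
  (forall z, z \in s -> acls (B ++ t) z) -> (size s <= size t)%N.
Proof.
elim: s B t => // a s IH B t free st.
have := free 0%N isT; rewrite take0 cats0 /= => nBa.
have [t1 [y [t2 [Et ya na]]]] := acls_split nBa (st a (mem_head _ _)).
have ay : acls (a :: B ++ t1) y.
  apply: (@acl_trans (fun w => w = a \/ w \in B ++ t1)).
    by move=> w [->|wB]; apply: acl_mem; rewrite inE ?eqxx // wB orbT.
  apply: acl_exchange na; apply: acl_trans ya => w; rewrite inE => /orP[/eqP->|wB].
    by apply: acl_mem; left.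
  by apply: acl_mem; right.
rewrite Et size_cat /= addnS ltnS -size_cat; apply: (IH (rcons B a)) => [m ms|z zs].
  by rewrite cat_rcons; apply: (free m.+1).
apply: acls_sub (st z _); last by rewrite inE zs orbT.
have sub w : w \in a :: B ++ t1 -> acls (rcons B a ++ t1 ++ t2) w.
  move=> wB; apply: acl_mem; move: wB.
  by rewrite !(inE, mem_cat, mem_rcons) => /or3P[->|->|->]; rewrite ?orbT.
move=> w; rewrite Et !(inE, mem_cat) => /or4P[wB|wt1|/eqP->|wt2].
- by apply: sub; rewrite inE mem_cat wB orbT.
- by apply: sub; rewrite inE mem_cat wt1 !orbT.
- exact: acls_sub ay.
- by apply: acl_mem; rewrite !mem_cat wt2 !orbT.
Qed.
End GeneratedSubfieldTheory.

Lemma muni_mwiden (n : nat) (R : comNzRingType) (a : {mpoly R[n]}) :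
  muni (mwiden a) = a%:P.
Proof.
rewrite /mwiden rmorph_mmap -[in RHS](comp_mpoly_id a) /comp_mpoly.
rewrite [RHS]rmorph_mmap; apply: eq_mmap => [c|j] /=; first exact: muniC.
rewrite tnth_mktuple muniE msuppX big_seq1 mcoeffX eqxx scale1r.
rewrite mnm1E; have -> : (widen_ord (leqnSn n) j == ord_max :> 'I_n.+1) = false.
  by apply/negbTE; rewrite -val_eqE /= ltn_eqF.
rewrite expr0 alg_polyC; congr (_%:P); congr mpolyX; apply/mnmP => b.
by rewrite mnmE !mnm1E -val_eqE.
Qed.

Lemma muniX_max (n : nat) (R : comNzRingType) :
  muni 'X_(ord_max : 'I_n.+1) = 'X :> {poly {mpoly R[n]}}.
Proof.
rewrite muniE msuppX big_seq1 mcoeffX eqxx scale1r mnm1E eqxx expr1.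
rewrite (_ : [multinom _ | _ < _] = 0%MM) ?mpolyX0 ?scale1r //.
by apply/mnmP => b; rewrite mnmE mnm1E mnm0E -val_eqE /= gtn_eqF.
Qed.

Lemma mmultiK (n : nat) (R : comNzRingType) : cancel (@mmulti n R) (@muni n R).
Proof.
move=> q; rewrite /mmulti rmorph_sum /= -[RHS]coefK poly_def.
apply: eq_bigr => a _; rewrite rmorphM rmorphXn /= muni_mwiden muniX_max.
by rewrite mul_polyC.
Qed.

Section Trdeg.
Variables (k K : fieldType) (i : {rmorphism k -> K}).

(** Only the last variable needs an argument: with denominators cleared, an equation for it over the
    others is a polynomial relation, transported by [mmulti]. Earlier variables follow by
    induction. *)
Lemma algebraically_independent_free (n : nat) (x : 'I_n -> K) (m : 'I_n) :
  algebraically_independent i x ->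
  ~ acl i (fun z => exists2 a : 'I_n, (a < m)%N & z = x a) (x m).
Proof.
elim: n x m => [|n IH] x m x_indep; first by case: m.
pose x' a := x (widen_ord (leqnSn n) a).
have mmapw p : mmap i x (mwiden p) = mmap i x' p.
  rewrite /mwiden rmorph_mmap; apply: eq_mmap => [c|j] /=; first by rewrite mmapC.
  by rewrite mmapX mmap1U.
have x'_indep : algebraically_independent i x'.
  move=> p p0; apply: (@inj_mwiden _ _); rewrite mwiden0; apply: x_indep.
  by rewrite mmapw.
have [mn|] := ltnP m n.
  have -> : m = widen_ord (leqnSn n) (Ordinal mn) by apply: val_inj.
  move=> xm; apply: (IH x' (Ordinal mn) x'_indep); apply: acl_trans xm => _ [a am ->].
  apply: acl_mem; exists (Ordinal (ltn_trans am mn)) => //.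
  by congr x; apply: val_inj.
move=> nm xm; have Em : m = ord_max.
  by apply/val_inj/eqP; rewrite /= eqn_leq nm -ltnS ltn_ord.
have {xm} : acl i (fun z => exists a, z = x' a) (x ord_max).
  rewrite -Em; apply: acl_trans xm => _ [a am ->]; apply: acl_mem.
  have an : (a < n)%N by move: am; rewrite Em.
  by exists (Ordinal an); congr x; apply: val_inj.
move=> /aclP[p [p0 Sp px]].
have [a|q [e [e0 Eq]]] := clear_denominators (ev := mmap i x') (p := p).
  apply: gen_subfield_fraction (Sp a) => [b|_ [b ->]].
    by exists b%:MP; rewrite /= mmapC.
  by exists 'X_b; rewrite /= mmapX mmap1U.
suff q0 : q = 0.
  move/eqP: Eq; rewrite q0 rmorph0 eq_sym scaler_eq0 (negPf p0) orbF.
  by apply/negP.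
rewrite -[q]mmultiK (x_indep (mmulti q)) ?muni0 //.
transitivity (map_poly (mmap i x') q).[x ord_max]; last first.
  by rewrite Eq hornerZ (rootP px) mulr0.
rewrite /mmulti rmorph_sum horner_coef /= size_map_poly_id0.
  by apply: eq_bigr => a _; rewrite rmorphM rmorphXn /= mmapw mmapX mmap1U coef_map.
(* Here the leading coefficient of [q] vanishes at x'; independence of x' again gives q = 0. *)
apply/eqP => E.
have := x'_indep _ E; move/eqP; rewrite lead_coef_eq0 => /eqP q0.
move/eqP: Eq; rewrite q0 rmorph0 eq_sym scaler_eq0 (negPf p0) orbF.
by apply/negP.
Qed.

Lemma transcendence_basis_leq (n n' : nat) (x : 'I_n -> K) (y : 'I_n' -> K) :
  algebraically_independent i x -> transcendence_basis i y -> (n <= n')%N.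
Proof.
move=> x_indep [_ y_span].
have szc (m : nat) (z : 'I_m -> K) : size (codom z) = m by rewrite size_codom card_ord.
have nthc (m : nat) (z : 'I_m -> K) (a : 'I_m) : (codom z)`_a = z a.
  by rewrite (nth_map a) ?nth_ord_enum // size_enum_ord.
rewrite -[n](szc n x) -[n'](szc n' y); apply: (@acls_steinitz _ _ i [::]) => [m|z _].
  rewrite szc => mn; rewrite (nthc _ x (Ordinal mn)) => xm.
  apply: (algebraically_independent_free (m := Ordinal mn) x_indep).
  apply: acl_trans xm => z /(nthP 0)[b]; rewrite /= size_takel ?szc; last exact: ltnW.
  move=> bm; rewrite nth_take // => <-; apply: acl_mem.
  by exists (Ordinal (ltn_trans bm mn)) => //; exact: (nthc _ x (Ordinal (ltn_trans bm mn))).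
apply: acl_trans (y_span z) => _ [a ->]; apply: acl_mem.
exact: codom_f.
Qed.

Lemma trdegE (n : nat) (x : 'I_n -> K) : transcendence_basis i x -> trdeg i = n.
Proof.
move=> xb; apply: nat_such_thatE; first by exists x.
move=> m [y yb]; apply/eqP; rewrite eqn_leq.
by rewrite (transcendence_basis_leq yb.1 xb) (transcendence_basis_leq xb.1 yb).
Qed.
End Trdeg.

(** * Linear algebra *)

Section LinearAlgebra.
Variables (k K : fieldType) (i : {rmorphism k -> K}).
Implicit Types (s t : seq K).

Lemma lin_span_subspace s : subspace i (lin_span i s).
Proof.
split; first by exists (fun=> 0); rewrite big1 // => m _; rewrite rmorph0 mul0r.
move=> c y z [a ->] [b ->]; exists (fun m => c * a m + b m).
rewrite mulr_sumr -big_split /=; apply: eq_bigr => m _.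
by rewrite rmorphD rmorphM; ring.
Qed.

Lemma lin_span_mem s z : z \in s -> lin_span i s z.
Proof.
move=> zs; have lt_zs : (index z s < size s)%N by rewrite index_mem.
exists (fun m => (m == Ordinal lt_zs)%:R).
rewrite (bigD1 (Ordinal lt_zs)) //= eqxx rmorph1 mul1r nth_index // big1 ?addr0 //.
by move=> m /negPf->; rewrite rmorph0 mul0r.
Qed.

Lemma subspace_sum (W : K -> Prop) (I : finType) (c : I -> k) (y : I -> K) :
  subspace i W -> (forall m, W (y m)) -> W (\sum_m i (c m) * y m).
Proof. by move=> [W0 WD] Wy; elim/big_rec: _ => // m z _ Wz; apply: WD. Qed.

Lemma lin_span_sub s t y :
  (forall z, z \in s -> lin_span i t z) -> lin_span i s y -> lin_span i t y.
Proof.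
move=> st [c ->]; apply: subspace_sum (lin_span_subspace t) _ => m.
exact/st/mem_nth.
Qed.

Lemma linearly_independent_size s t :
  linearly_independent i s -> (forall z, z \in s -> lin_span i t z) ->
  (size s <= size t)%N.
Proof.
move=> s_indep st; rewrite leqNgt; apply/negP => ts.
have coefs (m : 'I_(size s)) : exists c : 'I_(size t) -> k,
    s`_m = \sum_a i (c a) * t`_a by apply/st/mem_nth.
have [c cE] := choice coefs.
pose A := \matrix_(m, a) c m a.
have kerA : kermx A != 0.
  by rewrite -mxrank_eq0 mxrank_ker -lt0n subn_gt0 (leq_ltn_trans (rank_leq_col _)).
have [v /sub_kermxP vA /rV0Pn[m vm]] := rowV0Pn kerA.
case/eqP: vm; apply: (s_indep (fun a => v 0 a)).
under eq_bigr => a _ do rewrite cE mulr_sumr.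
rewrite exchange_big big1 // => b _ /=.
under eq_bigr => a _ do rewrite mulrA -rmorphM.
rewrite -mulr_suml -rmorph_sum.
have := congr1 (fun B : 'rV_(size t) => B 0 b) vA; rewrite !mxE => vAb.
have -> : \sum_a v 0 a * c a b = 0.
  by rewrite -[RHS]vAb; apply: eq_bigr => a _; rewrite mxE.
by rewrite rmorph0 mul0r.
Qed.

Lemma dimensionE (V : K -> Prop) s : basis_for i V s -> dimension i V = size s.
Proof.
move=> sV; apply: nat_such_thatE; first by exists s.
move=> m [t <- tV]; apply/eqP; rewrite eqn_leq.
by apply/andP; split; apply: linearly_independent_size => [|z zs];
  [exact: tV.1 | apply/sV.2/tV.2/lin_span_mem | exact: sV.1
  | apply/tV.2/sV.2/lin_span_mem].
Qed.

(** Separate the m-th vector from the span of the others. *)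
Lemma dual_functional s (m : 'I_(size s)) : linearly_independent i s ->
  exists f, functional i f /\ forall a : 'I_(size s), f s`_a = (a == m)%:R.
Proof.
move=> s_indep.
pose W y := exists c : 'I_(size s) -> k, c m = 0 /\ y = \sum_a i (c a) * s`_a.
have Wsub : subspace i W.
  split; first by exists (fun=> 0); split=> //; rewrite big1 // => a _; rewrite rmorph0 mul0r.
  move=> e y z [a [am ->]] [b [bm ->]]; exists (fun j => e * a j + b j).
  split; first by rewrite am bm mulr0 addr0.
  rewrite mulr_sumr -big_split /=; apply: eq_bigr => j _.
  by rewrite rmorphD rmorphM; ring.
have sumE (a : 'I_(size s)) : \sum_j i (j == a)%:R * s`_j = s`_a.
  rewrite (bigD1 a) //= eqxx rmorph1 mul1r big1 ?addr0 // => j /negPf->.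
  by rewrite rmorph0 mul0r.
have Wm : ~ W s`_m.
  move=> [c [cm E]]; have := s_indep (fun a => c a - (a == m)%:R).
  under eq_bigr => a _ do rewrite rmorphB mulrBl.
  rewrite sumrB sumE -E subrr => /(_ erefl m) /eqP.
  by rewrite cm eqxx sub0r oppr_eq0 oner_eq0.
have [f [f_lin fm fW]] := separating_functional Wsub Wm.
exists f; split=> // a; have [->|am] := eqVneq a m; first by [].
apply: fW; exists (fun j => (j == a)%:R); split; last by rewrite sumE.
by rewrite eq_sym (negPf am).
Qed.

(* The conclusion [e = 0] is automatic, [i] being injective. *)
Definition indep1 s := forall (c : 'I_(size s) -> k) (e : k),
  \sum_a i (c a) * s`_a + i e = 0 -> forall a, c a = 0.
Definition span1 s y := exists (c : 'I_(size s) -> k) (e : k),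
  y = \sum_a i (c a) * s`_a + i e.

Lemma indep1_linearly_independent s : indep1 s -> linearly_independent i (1 :: s).
Proof.
move=> s1 c; rewrite big_ord_recl /= mulr1 addrC => E m.
have c0 : forall a, c (lift ord0 a) = 0 by exact: s1 E.
have [j ->|->] := unliftP ord0 m; first exact: c0.
move: E; rewrite big1 => [|a _]; last by rewrite c0 rmorph0 mul0r.
by rewrite add0r => /eqP; rewrite fmorph_eq0 => /eqP.
Qed.

Lemma span1_lin_span s y : span1 s y -> lin_span i (1 :: s) y.
Proof.
move=> [c [e ->]]; exists (fun m => if unlift ord0 m is Some a then c a else e).
rewrite big_ord_recl unlift_none /= mulr1 addrC; congr (_ + _).
by apply: eq_bigr => a _; rewrite liftK.
Qed.

Lemma span1_not_indep1 s y : span1 s y -> ~ indep1 (y :: s).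
Proof.
move=> [c [e yE]] /(_ (fun m => if unlift ord0 m is Some a then c a else -1) e).
rewrite big_ord_recl unlift_none /= rmorphN1 mulN1r.
under eq_bigr => a _ do rewrite liftK.
rewrite -addrA -yE addNr => /(_ erefl ord0)/eqP.
by rewrite unlift_none oppr_eq0 oner_eq0.
Qed.

Lemma not_indep1_span1 s y : indep1 s -> ~ indep1 (y :: s) -> span1 s y.
Proof.
move=> s1 nys; apply: contrapT => nspan; apply: nys => c e.
rewrite big_ord_recl /= -addrA => E.
have c00 : c ord0 = 0.
  apply/eqP/negPn/negP => c0; apply: nspan.
  exists (fun a => - (c ord0)^-1 * c (lift ord0 a)), (- (c ord0)^-1 * e).
  under eq_bigr => a _ do rewrite rmorphM -mulrA.
  rewrite rmorphM -mulr_sumr -mulrDr rmorphN fmorphV mulNr.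
  apply: (mulfI (_ : i (c ord0) != 0)); first by rewrite fmorph_eq0.
  by rewrite mulrN mulrA divff ?fmorph_eq0 // mul1r; apply/eqP; rewrite -addr_eq0 E.
have := s1 (fun a => c (lift ord0 a)) e; rewrite c00 rmorph0 mul0r add0r in E.
move=> /(_ E) cl m; have [j ->|->] := unliftP ord0 m; by [].
Qed.

Lemma span1_cons s y z : span1 s y -> span1 (z :: s) y.
Proof.
move=> [c [e ->]]; exists (fun m => if unlift ord0 m is Some a then c a else 0), e.
rewrite big_ord_recl unlift_none /= rmorph0 mul0r add0r.
by congr (_ + _); apply: eq_bigr => a _; rewrite liftK.
Qed.

Lemma span1_head s y : span1 (y :: s) y.
Proof.
exists (fun m => if unlift ord0 m is Some a then 0 else 1), 0.
rewrite big_ord_recl unlift_none /= rmorph1 mul1r rmorph0 addr0 big1 ?addr0 //.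
by move=> a _; rewrite liftK rmorph0 mul0r.
Qed.
End LinearAlgebra.

(** * The difference structure *)

Section IterMorphism.
Variables (R : pzRingType) (f : {rmorphism R -> R}) (m : nat).
Definition iter_fun : R -> R := iter m f.
Fact iter_zmod : zmod_morphism iter_fun.
Proof. by rewrite /iter_fun; elim: m => //= m' IH x y /=; rewrite IH rmorphB. Qed.
Fact iter_monoid : monoid_morphism iter_fun.
Proof.
rewrite /iter_fun; elim: m => //= m' [I1 IM].
by split=> [|x y] /=; rewrite ?I1 ?IM ?rmorph1 ?rmorphM.
Qed.
HB.instance Definition _ := GRing.isZmodMorphism.Build R R iter_fun iter_zmod.
HB.instance Definition _ := GRing.isMonoidMorphism.Build R R iter_fun iter_monoid.
End IterMorphism.

Section SigmaStructure.
Variable T : sigma_admissible.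
Local Notation L := (ringL T).
Local Notation E := (fieldE T).
Local Notation d := (period T).
Local Notation Lf := (@factor T).
Local Notation iE := (E_to_L T).
Local Notation sg := (sigma T).
Implicit Types (l : 'I_d).

Lemma proj_inj (x y : L) : (forall l, proj l x = proj l y) -> x = y.
Proof.
move=> xy; have [z [_ zU]] := proj_bij (fun l => proj l y).
by rewrite -(zU x) // -(zU y).
Qed.

Definition supported l (x : L) := forall l', l' != l -> proj l' x = 0.

Lemma lift_exists l (x : Lf l) : exists y : L, proj l y = x /\ supported l y.
Proof.
have [y [yE _]] := proj_bij (dfwith (fun l' => 0 : Lf l') x).
exists y; split=> [|l' ll']; first by rewrite yE dfwith_in.
by rewrite yE dfwith_out // eq_sym.
Qed.

Definition lift_factor l (x : Lf l) : L := sval (cid (lift_exists x)).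
Lemma lift_factorK l (x : Lf l) : proj l (lift_factor x) = x.
Proof. by rewrite /lift_factor; case: cid => y []. Qed.
Lemma lift_factor_supported l (x : Lf l) : supported l (lift_factor x).
Proof. by rewrite /lift_factor; case: cid => y []. Qed.

(** Split x into its components: the one at l is zero, and sigma moves each of the others to a
    component different from l + 1. *)
Lemma proj_sigma_eq0 l (x : L) : proj l x = 0 -> proj (ordS l) (sg x) = 0.
Proof.
move=> x0; have -> : x = \sum_l' lift_factor (proj l' x).
  apply: proj_inj => l'; rewrite rmorph_sum (bigD1 l') //= lift_factorK.
  by rewrite big1 ?addr0 // => l'' ll; apply: lift_factor_supported; rewrite eq_sym.
rewrite !rmorph_sum big1 // => l' _.
have [<-|ll'] := eqVneq l l'.
  have -> : lift_factor (proj l x) = 0.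
    apply: proj_inj => l''; rewrite rmorph0; have [->|] := eqVneq l'' l.
      by rewrite lift_factorK x0.
    exact: lift_factor_supported.
  by rewrite !rmorph0.
apply: (sigma_shift (@lift_factor_supported l' (proj l' x))).
by rewrite (inj_eq (@ordS_inj _)).
Qed.

Lemma proj_iter_sigma_eq0 m l (x : L) :
  proj l x = 0 -> proj (iter m (@ordS d) l) (iter m sg x) = 0.
Proof. by move=> x0; elim: m => //= m; apply: proj_sigma_eq0. Qed.

Lemma supported_iter_sigma m l (x : L) :
  supported l x -> supported (iter m (@ordS d) l) (iter m sg x).
Proof. by move=> xl; elim: m => //= m IH; apply: sigma_shift. Qed.

Lemma val_iter_ordS m l : val (iter m (@ordS d) l) = ((l + m) %% d)%N.
Proof.
elim: m => [|m IH] /=; first by rewrite addn0 modn_small.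
by rewrite IH -addn1 modnDml addn1 addnS.
Qed.

Lemma iter_ordS_period l : iter d (@ordS d) l = l.
Proof. by apply: val_inj; rewrite val_iter_ordS modnDr modn_small. Qed.

Lemma iter_ordS_neq m l : (0 < m < d)%N -> iter m (@ordS d) l != l.
Proof.
move=> /andP[m0 md]; rewrite -val_eqE val_iter_ordS -[X in _ != X](modn_small (ltn_ord l)).
by rewrite -[X in _ != X %[mod _]]addn0 eqn_modDl mod0n modn_small // -lt0n.
Qed.

Lemma iter_ordS_onto l l' : exists m, iter m (@ordS d) l = l'.
Proof.
exists (l' + (d - l))%N; apply: val_inj; rewrite val_iter_ordS.
by rewrite addnCA subnKC ?modnDr ?modn_small // ltnW.
Qed.

Definition sigmaE (a : E) : E := sval (cid (@sigma_E T a)).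
Lemma sigmaEE a : sg (iE a) = iE (sigmaE a).
Proof. by rewrite /sigmaE; case: cid. Qed.
Fact sigmaE_zmod : zmod_morphism sigmaE.
Proof. by move=> a b; apply: (fmorph_inj iE); rewrite -sigmaEE !rmorphB !sigmaEE. Qed.
Fact sigmaE_monoid : monoid_morphism sigmaE.
Proof.
by split=> [|a b]; apply: (fmorph_inj iE); rewrite -?sigmaEE ?rmorph1 // !rmorphM !sigmaEE.
Qed.
HB.instance Definition _ := GRing.isZmodMorphism.Build E E sigmaE sigmaE_zmod.
HB.instance Definition _ := GRing.isMonoidMorphism.Build E E sigmaE sigmaE_monoid.

Lemma iter_sigmaEE m a : iter m sg (iE a) = iE (iter m sigmaE a).
Proof. by elim: m => //= m ->; rewrite sigmaEE. Qed.

Section Period.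
Variable l : 'I_d.

(** The endomorphism induced by the d-th iterate of sigma on L_l; [tau_proj] shows that any lift of
    x may be used. *)
Definition tau (x : Lf l) : Lf l := proj l (iter_fun sg d (lift_factor x)).

Lemma tau_proj (y : L) : tau (proj l y) = proj l (iter d sg y).
Proof.
apply/eqP; rewrite -subr_eq0 -rmorphB -(rmorphB (iter_fun sg d)).
set z := _ - _; have z0 : proj l z = 0 by rewrite rmorphB lift_factorK subrr.
have := proj_iter_sigma_eq0 d z0; rewrite iter_ordS_period.
by move/eqP.
Qed.

Fact tau_zmod : zmod_morphism tau.
Proof.
move=> x y; rewrite -{1}[x]lift_factorK -{1}[y]lift_factorK -rmorphB tau_proj.
by rewrite -/(iter_fun sg d _) !rmorphB.
Qed.
Fact tau_monoid : monoid_morphism tau.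
Proof.
split=> [|x y]; first by rewrite -(rmorph1 (proj l)) tau_proj -/(iter_fun sg d _) !rmorph1.
rewrite -{1}[x]lift_factorK -{1}[y]lift_factorK -rmorphM tau_proj.
by rewrite -/(iter_fun sg d _) !rmorphM.
Qed.
HB.instance Definition _ := GRing.isZmodMorphism.Build (Lf l) (Lf l) tau tau_zmod.
HB.instance Definition _ := GRing.isMonoidMorphism.Build (Lf l) (Lf l) tau tau_monoid.

Lemma tau_E a : tau (E_to_factor l a) = E_to_factor l (iter d sigmaE a).
Proof. by rewrite /E_to_factor /= tau_proj iter_sigmaEE. Qed.

(* A tau-fixed x in L_l spreads to the sigma-fixed sum of its d translates. *)
Lemma tau_fixed (x : Lf l) : tau x = x -> exists a, x = E_to_factor l a.
Proof.
move=> tx; pose y := lift_factor x; pose z := \sum_(m < d) iter m sg y.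
have yd : iter d sg y = y.
  apply: proj_inj => l'; have [->|ll'] := eqVneq l' l.
    by rewrite -tau_proj lift_factorK tx.
  rewrite [RHS]lift_factor_supported //.
  have := supported_iter_sigma (m := d) (@lift_factor_supported l x).
  by rewrite iter_ordS_period; apply.
have /sigma_fixed_L[b zb] : sg z = z.
  rewrite /z rmorph_sum; have := period_gt0 T; move: yd.
  case: (d : nat) => // d' yd _; rewrite big_ord_recr [RHS]big_ord_recl /=.
  by rewrite -[sg _]/(iter d'.+1 sg y) yd addrC.
exists (F_to_E T b); rewrite /E_to_factor /= -zb /z rmorph_sum.
rewrite (bigD1 (Ordinal (period_gt0 T))) //= lift_factorK big1 ?addr0 // => m m0.
have := supported_iter_sigma (m := m) (@lift_factor_supported l x); apply.
rewrite eq_sym; apply: iter_ordS_neq; rewrite ltn_ord andbT lt0n.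
by apply: contraNneq m0 => m0; apply/eqP/val_inj.
Qed.
End Period.
End SigmaStructure.

(** * The theorem *)

Lemma indep1P (k K : fieldType) (i : {rmorphism k -> K}) (s : seq K) m : size s = m ->
  indep1 i s <-> forall (c : 'I_m -> k) (e : k),
    \sum_a i (c a) * s`_a + i e = 0 -> forall a, c a = 0.
Proof. by move=> <-. Qed.

Lemma algebraic_root (k K : fieldType) (i : {rmorphism k -> K}) (x : K) n :
  (0 < n)%N -> algebraicOver i (x ^+ n) -> algebraicOver i x.
Proof.
move=> n0 xn; apply/integral_algebraic.
apply: (@integral_root _ _ _ ('X^n - (x ^+ n)%:P)).
- by apply: monic_neq0; rewrite monicXnsubC.
- by rewrite rootE !hornerE subrr.
apply/integral_poly => a; rewrite coefB coefXn coefC; apply: integral_sub.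
  exact: integral_nat.
by case: eqP => _; [exact/integral_algebraic | exact: integral0].
Qed.

(** Separability is given for L, not for L_l, so 1 and the entries of [s] are lifted to L by zero
    off l and the relation is checked componentwise. [separable_frobenius] with the functional dual
    to s_a isolates c_a. *)
Lemma frobenius_independent (T : sigma_admissible) (l : 'I_(period T))
    (s : seq (factor l)) (D : nat) (c : 'I_(size s) -> fieldE T) e :
  indep1 (E_to_factor l) s -> [pchar (fieldE T)].-nat D ->
  \sum_a E_to_factor l (c a) * s`_a ^+ D + E_to_factor l e = 0 ->
  forall a, c a = 0.
Proof.
move=> s_indep D_p rel a.
have D_gt0 : (0 < D)%N by case/andP: D_p.
pose m : 'I_(size (1 :: s)) := lift ord0 a.
have [f [f_lin f_dual]] := dual_functional m (indep1_linearly_independent s_indep).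
pose c' (j : 'I_(size (1 :: s))) := if unlift ord0 j is Some b then c b else e.
pose x (j : 'I_(size (1 :: s))) := lift_factor ((1 :: s)`_j).
have := @separable_frobenius _ _ (E_to_L T) D _ x c' (f \o proj l) (@L_separable T) D_p.
have <- : \sum_j f (proj l (x j)) ^+ D * c' j = c a.
  rewrite (bigD1 m) //= /x lift_factorK f_dual eqxx expr1n mul1r {1}/c' liftK.
  rewrite big1 ?addr0 // => j jm; rewrite lift_factorK f_dual (negPf jm).
  by rewrite expr0n (gtn_eqF D_gt0) mul0r.
apply=> [c0 y z|].
  by rewrite /= rmorphD rmorphM; apply: f_lin.
apply: proj_inj => l'; rewrite rmorph0 rmorph_sum.
have [->|ll'] := eqVneq l' l; last first.
  rewrite big1 // => j _; rewrite rmorphM rmorphXn /x lift_factor_supported //.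
  by rewrite expr0n (gtn_eqF D_gt0) mulr0.
rewrite -[RHS]rel big_ord_recl addrC; congr (_ + _).
  apply: eq_bigr => j _; rewrite rmorphM rmorphXn /x lift_factorK /=.
  by rewrite /c' liftK.
by rewrite rmorphM rmorphXn /x lift_factorK /= /c' unlift_none expr1n mulr1.
Qed.

(** * The entries of Psi: linear relations, algebraic relations and the two degrees *)

Section PeriodMatrix.
Variable T : sigma_admissible.
Local Notation L := (ringL T).
Local Notation E := (fieldE T).
Local Notation d := (period T).
Local Notation Lf := (@factor T).
Local Notation iE := (E_to_L T).
Local Notation sg := (sigma T).
Variables (t theta : E) (n r : nat) (alpha : 'I_r -> E).
Variables (Omega : L) (Lpol : 'I_r -> L).
Hypotheses (t_neq_theta : t != theta) (n_gt0 : (0 < n)%N).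
Hypothesis Omega_unit : Omega \is a GRing.unit.
Hypothesis sigma_Omega : sg Omega = iE (t - theta) * Omega.
Hypothesis Omega_transcendental :
  forall l, ~ algebraicOver (E_to_factor l) (proj l Omega).
Hypothesis sigma_Lpol : forall j, sg (Lpol j) =
  sg (iE (alpha j)) + Lpol j / iE (t - theta) ^+ n.

Let w : L := Omega ^- n.
Let u : E := (t - theta) ^- n.

Let u_neq0 : u != 0.
Proof. by rewrite invr_eq0 expf_neq0 // subr_eq0. Qed.

Let sigma_w : sg w = iE u * w.
Proof.
have iE_unit : iE (t - theta) \is a GRing.unit.
  by apply: rmorph_unit; rewrite unitfE subr_eq0.
rewrite /w /u !rmorphV ?unitrX // ?unitfE ?expf_neq0 ?subr_eq0 //.
by rewrite !rmorphXn sigma_Omega exprMn invrM ?unitrX // mulrC.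
Qed.

Let sigma_affine j : exists b, sg (Lpol j) = iE u * Lpol j + iE b.
Proof.
exists (sigmaE (alpha j)); rewrite sigma_Lpol sigmaEE addrC mulrC /u.
by rewrite rmorphV ?rmorphXn // unitfE expf_neq0 // subr_eq0.
Qed.

(** The same multiplier v serves w and every L_j, as [affine_relation] requires. *)
Let iter_affine m : exists v, [/\ v != 0, iter m sg w = iE v * w &
  forall j, exists b, iter m sg (Lpol j) = iE v * Lpol j + iE b].
Proof.
elim: m => [|m [v [v0 vw vL]]].
  exists 1; rewrite oner_neq0 rmorph1 mul1r; split=> // j.
  by exists 0; rewrite rmorph0 addr0 mul1r.
exists (sigmaE v * u); split; first by rewrite mulf_neq0 // fmorph_eq0.
  by rewrite /= vw rmorphM sigma_w sigmaEE rmorphM mulrA.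
move=> j; have [b Eb] := vL j; have [b' Eb'] := sigma_affine j.
exists (sigmaE v * b' + sigmaE b); rewrite /= Eb rmorphD rmorphM Eb' !sigmaEE.
by rewrite !(rmorphM, rmorphD); ring.
Qed.

(** w is placed last, so its index is [size J]. *)
Let gens (J : seq 'I_r) : seq L := rcons [seq Lpol j | j <- J] w.
Let pgens l J : seq (Lf l) := map (proj l) (gens J).

Let size_pgens l J : size (pgens l J) = size (gens J).
Proof. exact: size_map. Qed.

Let nth_pgens l J (a : 'I_(size (gens J))) : (pgens l J)`_a = proj l (gens J)`_a.
Proof. by rewrite (nth_map 0). Qed.

Let nth_pgens_w l J : (pgens l J)`_(size J) = proj l w.
Proof.
by rewrite (nth_map 0) /gens ?size_rcons ?size_map // nth_rcons size_map ltnn eqxx.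
Qed.

Let nth_pgens_Lpol l J a : (a < size J)%N -> exists j, (pgens l J)`_a = proj l (Lpol j).
Proof.
move=> aJ; have aJ' : (a < size (map Lpol J))%N by rewrite size_map.
have /mapP[j _ Ej] := mem_nth 0 aJ'; exists j.
by rewrite (nth_map 0) /gens ?size_rcons ?nth_rcons ?aJ' ?Ej // ltnW.
Qed.

Let gensP J y : y \in gens J -> y = w \/ exists j, y = Lpol j.
Proof. by rewrite mem_rcons inE => /orP[/eqP->|/mapP[j _ ->]]; [left|right; exists j]. Qed.

Let gens_affine J y : y \in gens J -> exists b, sg y = iE u * y + iE b.
Proof.
move=> /gensP[->|[j ->]]; last exact: sigma_affine.
by exists 0; rewrite sigma_w rmorph0 addr0.
Qed.

Local Notation indep l J := (indep1 (E_to_factor l) (pgens l J)).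

(** Sigma turns a relation at l with coefficients c_a into one at l + 1 with coefficients sigma(c_a)
    u; as u is nonzero and sigma is injective on E, the c_a vanish too. *)
Let indep_shift l J : indep (ordS l) J -> indep l J.
Proof.
move/(indep1P _ (size_pgens _ _)) => ind; apply/(indep1P _ (size_pgens _ _)) => c e E0.
have aff (a : 'I_(size (gens J))) : exists b, sg (gens J)`_a = iE u * (gens J)`_a + iE b.
  by apply/(gens_affine (J := J))/mem_nth.
have [b bE] := choice aff.
pose X := \sum_a iE (c a) * (gens J)`_a + iE e.
have X0 : proj l X = 0.
  rewrite -[RHS]E0 rmorphD rmorph_sum; congr (_ + _); apply: eq_bigr => a _.
  by rewrite rmorphM nth_pgens.
have := proj_sigma_eq0 X0.
have -> : sg X = \sum_a iE (sigmaE (c a) * u) * (gens J)`_a +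
    iE (\sum_a sigmaE (c a) * b a + sigmaE e).
  rewrite /X rmorphD !rmorph_sum sigmaEE rmorphD rmorph_sum addrA -big_split /=.
  by congr (_ + _); apply: eq_bigr => a _; rewrite [LHS]rmorphM bE sigmaEE !rmorphM; ring.
rewrite rmorphD rmorph_sum => Y0 a.
have := ind (fun a => sigmaE (c a) * u) (\sum_a sigmaE (c a) * b a + sigmaE e).
have -> : \sum_a E_to_factor (ordS l) (sigmaE (c a) * u) * (pgens (ordS l) J)`_a =
    \sum_a proj (ordS l) (iE (sigmaE (c a) * u) * (gens J)`_a).
  by apply: eq_bigr => b' _; rewrite [RHS]rmorphM nth_pgens.
move=> /(_ Y0 a)/eqP; rewrite mulf_eq0 (negPf u_neq0) orbF fmorph_eq0.
by move/eqP.
Qed.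

Let indep_all l l' J : indep l J -> indep l' J.
Proof.
have [m <-] := iter_ordS_onto l' l.
by elim: m => //= m IH /indep_shift.
Qed.

Let proj_w l : proj l w = proj l Omega ^- n.
Proof. by rewrite /w rmorphV ?unitrX // rmorphXn. Qed.

Let w_transcendental l : ~ algebraicOver (E_to_factor l) (proj l w).
Proof.
move=> /algebraic_inv; rewrite proj_w invrK => /(algebraic_root n_gt0).
exact: Omega_transcendental.
Qed.

Lemma indep_nil l : indep l [::].
Proof.
move=> c e; rewrite big_ord1 /= => E0 a; rewrite [a]ord1.
apply/eqP/negPn/negP => c0; apply: (@w_transcendental l).
have -> : proj l w = E_to_factor l (- e / c ord0).
  apply: (mulfI (_ : E_to_factor l (c ord0) != 0)); first by rewrite fmorph_eq0.
  rewrite -[RHS]rmorphM [c ord0 * _]mulrC divfK // rmorphN; apply/eqP.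
  by rewrite -addr_eq0 E0.
exact: algebraic_id.
Qed.

Let basis_exists l : exists J, indep l J /\
  forall j, span1 (E_to_factor l) (pgens l J) (proj l (Lpol j)).
Proof.
suff [J [Ji Js]] : exists J, indep l J /\
    forall j, j \in enum 'I_r -> span1 (E_to_factor l) (pgens l J) (proj l (Lpol j)).
  by exists J; split=> // j; apply: Js; rewrite mem_enum.
elim: (enum _) => [|j s [J [Ji Js]]]; first by exists [::]; split=> //; apply: indep_nil.
have [jJi|njJi] := pselect (indep l (j :: J)).
  exists (j :: J); split=> // j'; rewrite inE => /orP[/eqP->|/Js].
    exact: span1_head.
  exact: span1_cons.
exists J; split=> // j'; rewrite inE => /orP[/eqP->|/Js //].
exact: not_indep1_span1.
Qed.

(** A maximal independent [J] at one component stays maximal at all others, since independence of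
    [j :: J] does not depend on l either. *)
Let basis_exists_all : exists J, forall l, indep l J /\
  forall j, span1 (E_to_factor l) (pgens l J) (proj l (Lpol j)).
Proof.
pose l0 := Ordinal (period_gt0 T).
have [J [Ji Js]] := basis_exists l0; exists J => l; split; first exact: indep_all Ji.
move=> j; apply: not_indep1_span1; first exact: indep_all Ji.
by move=> /(@indep_all l l0 (j :: J)); apply: span1_not_indep1 (Js j).
Qed.

Let indep_algebraically_independent l J : indep l J ->
  algebraically_independent (E_to_factor l) (fun a : 'I_(size (pgens l J)) => (pgens l J)`_a).
Proof.
move=> Ji P Px0; apply/eqP/negPn/negP => P0.
have szJ : (size J < size (pgens l J))%N.
  by rewrite size_pgens size_rcons size_map.
pose o := Ordinal szJ.
have [v [v0 vw vL]] := iter_affine d.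
have nth_o : (pgens l J)`_o = proj l w.
  exact: nth_pgens_w.
(* The clause on [o] ensures that the constants chosen below vanish at the index of w. *)
have aff (a : 'I_(size (pgens l J))) : exists b,
    tau (pgens l J)`_a = E_to_factor l v * (pgens l J)`_a + E_to_factor l b
    /\ (a = o -> b = 0).
  have [->|ao] := eqVneq a o.
    exists 0; split=> //; rewrite nth_o tau_proj vw rmorphM rmorph0 addr0.
    by [].
  have aJ : (a < size J)%N.
    have := ltn_ord a; rewrite {2}size_pgens size_rcons size_map ltnS leq_eqVlt.
    by case/orP=> // /eqP aJ; case/eqP: ao; apply: val_inj.
  have [j Ej] := nth_pgens_Lpol l aJ.
  have [b Eb] := vL j; exists b; split; last by move=> E'; rewrite E' eqxx in ao.
  by rewrite Ej tau_proj Eb rmorphD rmorphM.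
have [beta betaE] := choice aff.
have [D [c [e [D_p rel [j cj]]]]] :=
  @affine_relation E (Lf l) (E_to_factor l) (iter_fun (@sigmaE T) d) (@tau T l)
   (@tau_E T l) (@tau_fixed T l) _ _ o v beta v0 (fun a => (betaE a).1) ((betaE o).2 erefl)
   (eq_ind_r (fun z => ~ algebraicOver _ z) (@w_transcendental l) nth_o) P P0 Px0.
by case/eqP: cj; apply: frobenius_independent rel j.
Qed.

Local Notation S l := (fun x => exists a b, x = proj l (Psi n Omega Lpol a b)).

Let Psi00 : Psi n Omega Lpol (lshift r 0) (lshift r 0) = Omega ^+ n.
Proof. by rewrite /Psi block_mxEul mxE eqxx mulr1n. Qed.

Let Psij0 j : Psi n Omega Lpol (rshift 1 j) (lshift r 0) = Omega ^+ n * Lpol j.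
Proof. by rewrite /Psi block_mxEdl mxE. Qed.

Let pgens_gen l J a : (a < size (pgens l J))%N ->
  (pgens l J)`_a \in gen_subfield (E_to_factor l) (S l).
Proof.
have wS : proj l w \in gen_subfield (E_to_factor l) (S l).
  rewrite proj_w -rmorphXn rpredV; apply: gen_subfield_mem.
  by do 2!exists (lshift r 0); rewrite Psi00.
move=> aJ; have -> : (pgens l J)`_a = proj l (gens J)`_a.
  by apply: nth_map; rewrite -(size_pgens l).
have [->//|[j ->]] : (gens J)`_a = w \/ exists j, (gens J)`_a = Lpol j.
  by apply/(@gensP J)/mem_nth; rewrite -(size_pgens l).
have -> : Lpol j = w * Psi n Omega Lpol (rshift 1 j) (lshift r 0).
  by rewrite Psij0 mulKr ?unitrX.
rewrite rmorphM; apply: rpredM wS _; apply: gen_subfield_mem.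
by exists (rshift 1 j), (lshift r 0).
Qed.

(** The entries Omega^n = 1 / w and Omega^n L_j = L_j / w lie in the field generated over E by w and
    the L_j with j in [J], so this family generates Lambda_l. *)
Let trdeg_Lambda l J : indep l J ->
  (forall j, span1 (E_to_factor l) (pgens l J) (proj l (Lpol j))) ->
  trdeg (E_to_Lambda n Omega Lpol l) = (size J).+1.
Proof.
move=> Ji Js.
pose z (a : 'I_(size (pgens l J))) : Lambda n Omega Lpol l :=
  Sub (pgens l J)`_a (pgens_gen (ltn_ord a)).
rewrite -[RHS](_ : size (pgens l J) = _); last by rewrite size_pgens size_rcons size_map.
apply: (@trdegE _ _ _ _ z); split=> [p p0|y].
  apply: (indep_algebraically_independent Ji).
  have := congr1 val p0; rewrite rmorph0 rmorph_mmap => E0.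
  by rewrite -[RHS]E0; apply: eq_mmap.
apply: acl_gen; set Z := fun z' => _.
(* The transcendence basis lives in the subtype Lambda_l, whereas Lambda_l is generated inside L_l;
   [M] transfers membership between the two. *)
pose M x := exists y : Lambda n Omega Lpol l,
  val y = x /\ y \in gen_subfield (E_to_Lambda n Omega Lpol l) Z.
suff gen x : x \in gen_subfield (E_to_factor l) (S l) -> M x.
  by have [y' [/val_inj -> //]] := gen _ (valP y).
have base a : M (E_to_factor l a).
  by exists (E_to_Lambda n Omega Lpol l a); split=> //; apply: gen_subfield_base.
have wZ : M (proj l w).
  have szJ : (size J < size (pgens l J))%N.
    by rewrite size_pgens size_rcons size_map.
  exists (z (Ordinal szJ)); split; last by apply: gen_subfield_mem; exists (Ordinal szJ).
  exact: nth_pgens_w.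
have LZ j : M (proj l (Lpol j)).
  have [c [e ->]] := Js j.
  exists (\sum_a E_to_Lambda n Omega Lpol l (c a) * z a + E_to_Lambda n Omega Lpol l e).
  split; first by rewrite rmorphD rmorph_sum.
  apply: rpredD; last exact: gen_subfield_base.
  apply: rpred_sum => a _; apply: rpredM; first exact: gen_subfield_base.
  by apply: gen_subfield_mem; exists a.
move: x; apply: (@gen_subfield_min _ _ _ _ M) => //.
- by exists 1; split; [exact: rmorph1 | exact: rpred1].
- move=> _ _ [x' [<- x'Z]] [y' [<- y'Z]]; exists (x' - y').
  by split; [exact: rmorphB | exact: rpredB].
- move=> _ _ [x' [<- x'Z]] [y' [<- y'Z]]; exists (x' / y').
  by split; [exact: fmorph_div | exact: rpred_div].
have [y0 [y0E y0Z]] := base 0; have [y1 [y1E y1Z]] := base 1.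
have [yw [ywE ywZ]] := wZ.
have On : proj l (Omega ^+ n) = (proj l w)^-1.
  by rewrite proj_w invrK rmorphXn.
have ywV : val yw^-1 = proj l (Omega ^+ n).
  by rewrite On -ywE; apply: (fmorphV (\val : Lambda n Omega Lpol l -> _)).
move=> x [a [b ->]]; rewrite -(splitK a) -(splitK b) /Psi.
case: (split a) => a'; case: (split b) => b' /=.
- rewrite block_mxEul mxE !ord1 eqxx mulr1n; exists yw^-1.
  by rewrite ywV rpredV.
- by rewrite block_mxEur mxE; exists y0; rewrite y0E !rmorph0.
- rewrite block_mxEdl mxE; have [yL [yLE yLZ]] := LZ a'; exists (yw^-1 * yL).
  split; last by rewrite rpredM ?rpredV.
  by rewrite -[LHS]/(val yw^-1 * val yL) ywV yLE !rmorphM.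
- rewrite block_mxEdr mxE; case: (_ == _).
    by exists y1; split=> //; rewrite y1E rmorph1; exact/esym/rmorph1.
  by exists y0; split=> //; rewrite y0E rmorph0; exact/esym/rmorph0.
Qed.

Let dimension_N l J : indep l J ->
  (forall j, span1 (E_to_factor l) (pgens l J) (proj l (Lpol j))) ->
  dimension (E_to_factor l) (Nspace n Omega Lpol l) = (size J).+2.
Proof.
move=> Ji Js; rewrite -[RHS](_ : size (1 :: pgens l J) = _); last first.
  by rewrite /= size_pgens size_rcons size_map.
apply: dimensionE; split; first exact: indep1_linearly_independent.
have memN y : y \in Nspace_gens n Omega Lpol l =
    [|| y == 1, y == proj l w | y \in [seq proj l (Lpol j) | j <- enum 'I_r]].
  by rewrite /Nspace_gens mem_rcons inE mem_rcons inE proj_w.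
have wN : proj l w \in 1 :: pgens l J.
  by rewrite inE (map_f (proj l)) ?orbT // mem_rcons mem_head.
move=> y; split; apply: lin_span_sub => {}y.
  rewrite memN => /or3P[/eqP->|/eqP->|/mapP[j _ ->]].
  - exact/lin_span_mem/mem_head.
  - exact: lin_span_mem.
  - exact/span1_lin_span.
rewrite inE => /orP[/eqP->|/mapP[x /gensP[->|[j ->]] ->]]; apply: lin_span_mem; rewrite memN.
- by rewrite eqxx.
- by rewrite eqxx orbT.
- by rewrite (map_f (fun j => proj l (Lpol j))) ?mem_enum // !orbT.
Qed.

Lemma dimension_trdeg l l' :
  dimension (E_to_factor l) (Nspace n Omega Lpol l) =
  (trdeg (E_to_Lambda n Omega Lpol l')).+1.
Proof.
have [J bJ] := basis_exists_all.
have [Ji Js] := bJ l; have [Ji' Js'] := bJ l'.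
by rewrite (dimension_N Ji Js) (trdeg_Lambda Ji' Js').
Qed.
End PeriodMatrix.

Theorem theorem7p3 (T : sigma_admissible)
  (F_units_not_torsion :
     ~ (forall a : fieldF T, a != 0 -> exists2 m : nat, (0 < m)%N & a ^+ m = 1))
  (t theta : fieldE T) (t_neq_theta : t != theta)
  (n r : nat) (n_gt0 : (0 < n)%N) (r_gt0 : (0 < r)%N)
  (alpha : 'I_r -> fieldE T)
  (Omega : ringL T) (Omega_unit : Omega \is a GRing.unit)
  (Lpol : 'I_r -> ringL T)
  (sigma_Omega : sigma T Omega = E_to_L T (t - theta) * Omega)
  (Omega_transcendental : forall l, ~ algebraicOver (E_to_factor l) (proj l Omega))
  (sigma_Lpol : forall j, sigma T (Lpol j) =
     sigma T (E_to_L T (alpha j)) + Lpol j / E_to_L T (t - theta) ^+ n)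
  (dense_or_regular :
     Gamma_F_dense (Psi n Omega Lpol) \/
     (forall l, regular_extension (F_to_Lambda n Omega Lpol l))) :
  forall l l' : 'I_(period T),
    (trdeg (E_to_Lambda n Omega Lpol l') <=
       dimension (E_to_factor l) (Nspace n Omega Lpol l))%N /\
    (dimension (E_to_factor l) (Nspace n Omega Lpol l) <=
       (trdeg (E_to_Lambda n Omega Lpol l')).+1)%N.
Proof.
move=> l l'; have -> := dimension_trdeg t_neq_theta n_gt0 Omega_unit sigma_Omega
  Omega_transcendental sigma_Lpol l l'.
by rewrite leqnn leqnSn.
Qed.
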